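(* Let $A,B\in\mathcal P(d)$, let $N(\cdot)$ be a strictly convex unitarily invariant norm on $\mathcal M_d(\mathbb C)$, and consider the function $F_N:\mathcal O_B\to\mathbb R_{\ge 0}$ given by $$F_N(C)=N\left(\log\left(A^{-1/2}CA^{-1/2}\right)\right),\qquad C\in\mathcal O_B .$$ If $C_0\in\mathcal O_B$ is a local minimizer of $F_N$ in $\mathcal O_B$, then there exists $U\in\mathcal U(d)$ such that $$U^*AU=D_{\lambda(A)}\quad\text{and}\quad U^*C_0U=D_{\lambda(B)} .$$ In particular, $C_0$ is a global minimizer of $F_N$ in $\mathcal O_B$.
   Context: $\mathcal M_d(\mathbb C)$ is the algebra of complex $d\times d$ matrices, $\mathcal P(d)$ is the set of (strictly) positive definite matrices in $\mathcal M_d(\mathbb C)$, and $\mathcal U(d)$ is the group of unitary $d\times d$ matrices. For a selfadjoint matrix $A$, $\lambda(A)=(\lambda_i(A))_{i=1}^d\in\mathbb R^d$ is the vector of eigenvalues of $A$, counting multiplicities and arranged in non-increasing order. For $x\in\mathbb C^d$, $D_x$ is the diagonal matrix with main diagonal $x$. For $B\in\mathcal P(d)$, the unitary orbit is $\mathcal O_B=\{U^*BU: U\in\mathcal U(d)\}$, regarded as a metric space with the metric induced by the operator (spectral) norm; local minimizers are understood with respect to this metric. The logarithm of a positive definite matrix is its selfadjoint logarithm (functional calculus). A norm $N$ on $\mathcal M_d(\mathbb C)$ is unitarily invariant if $N(UXV)=N(X)$ for all $X\in\mathcal M_d(\mathbb C)$ and $U,V\in\mathcal U(d)$; it is strictly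 convex if its restriction to diagonal matrices is a strictly convex norm on $\mathbb C^d$. *)

(* Defs.v *)
From HB Require Import structures.
From mathcomp Require Import all_boot all_order all_algebra.
From mathcomp Require Import all_classical all_reals all_analysis.
From mathcomp Require Import complex.

Set Implicit Arguments.
Unset Strict Implicit.
Unset Printing Implicit Defensive.

Import Order.TTheory GRing.Theory Num.Theory.
Local Open Scope ring_scope.
Local Open Scope classical_set_scope.
Local Open Scope complex_scope.
Local Open Scope sesquilinear_scope.

Section Matrices.
Variables (R : realType) (d : nat).
Local Notation C := R[i].

(* The order of R[i] is partial: 0 < z forces z to be real. *)
Definition posdef : set 'M[C]_d :=
  [set A | A \is hermsymmx /\
           forall v : 'cV[C]_d, v != 0 -> 0 < (v^t* *m A *m v) 0 0].

(* spectral_diag A lists the eigenvalues of a normal matrix with their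
   multiplicities, in no specified order; for A selfadjoint they are real, so
   that taking real parts only changes the type. *)
Definition eigvals (A : 'M[C]_d) : 'rV[R]_d :=
  \row_i nth 0 (sort >=%R [seq complex.Re (spectral_diag A 0 j) | j <- enum 'I_d]) i.

Definition diagC (x : 'rV[R]_d) : 'M[C]_d :=
  diag_mx (map_mx (fun t : R => t%:C) x).

(* Functional calculus for selfadjoint A, through the spectral decomposition
   A = P^-1 diag(s) P with P unitary and s real. *)
Definition funcalc (f : R -> R) (A : 'M[C]_d) : 'M[C]_d :=
  invmx (spectralmx A)
    *m diagC (\row_j f (complex.Re (spectral_diag A 0 j)))
    *m spectralmx A.

Definition logmx (A : 'M[C]_d) : 'M[C]_d := funcalc (@ln R) A.

Definition invsqrtmx (A : 'M[C]_d) : 'M[C]_d :=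
  funcalc (fun t => (Num.sqrt t)^-1) A.

Definition unitary_orbit (B : 'M[C]_d) : set 'M[C]_d :=
  [set U^t* *m B *m U | U in [set U : 'M[C]_d | U \is unitarymx]].

Definition l2norm (v : 'cV[C]_d) : R :=
  Num.sqrt (\sum_i complex.Re `|v i 0| ^+ 2).

Definition opnorm (X : 'M[C]_d) : R :=
  sup [set l2norm (X *m v) | v in [set v : 'cV[C]_d | l2norm v <= 1]].

(* Norm on a complex vector space V, with values in R; nonnegativity follows. *)
Definition is_norm (V : lmodType C) (N : V -> R) : Prop :=
  [/\ forall X Y, N (X + Y) <= N X + N Y,
      forall (a : C) X, N (a *: X) = complex.Re `|a| * N X
    & forall X, N X = 0 -> X = 0].

Definition strictly_convex (V : lmodType C) (n : V -> R) : Prop :=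
  forall x y, n x = 1 -> n y = 1 -> x != y ->
  forall t : R, 0 < t -> t < 1 -> n (t%:C *: x + (1 - t)%:C *: y) < 1.

Definition unitarily_invariant (N : 'M[C]_d -> R) : Prop :=
  forall X U V : 'M[C]_d, U \is unitarymx -> V \is unitarymx ->
  N (U *m X *m V) = N X.

Definition strictly_convex_ui_norm (N : 'M[C]_d -> R) : Prop :=
  [/\ is_norm N, unitarily_invariant N
    & strictly_convex (fun x : 'rV[C]_d => N (diag_mx x))].

Definition F_ (N : 'M[C]_d -> R) (A M : 'M[C]_d) : R :=
  N (logmx (invsqrtmx A *m M *m invsqrtmx A)).

Definition local_minimizer (F : 'M[C]_d -> R) (S : set 'M[C]_d) (M0 : 'M[C]_d) :=
  S M0 /\ exists2 e : R, 0 < e &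
    forall M, S M -> opnorm (M - M0) < e -> F M0 <= F M.

Definition global_minimizer (F : 'M[C]_d -> R) (S : set 'M[C]_d) (M0 : 'M[C]_d) :=
  S M0 /\ forall M, S M -> F M0 <= F M.

End Matrices.

(* Main.v *)
Require Import Defs.
From HB Require Import structures.
From mathcomp Require Import all_boot all_order all_algebra.
From mathcomp Require Import all_classical all_reals all_analysis.
From mathcomp Require Import complex ring lra.

Set Implicit Arguments.
Unset Strict Implicit.
Unset Printing Implicit Defensive.

Import Order.TTheory GRing.Theory Num.Theory.
Local Open Scope ring_scope.
Local Open Scope sesquilinear_scope.

(** Let [T = A^(-1/2)] and [S = T C0 T], so that the function to minimize is
    the norm of [log S].  Near a local minimizer [C0] one can only move [C0] by
    unitary conjugations, and [S] changes accordingly; conjugating [S] itself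
    changes nothing.  Two kinds of moves show that [C0] has to be aligned with
    [A].

    First-order moves force [C0] to commute with [A] ([local_min_comm]).  If
    [S] does not commute with [T^2], the inverse of [A], then neither does
    [log S].  Averaging [log S] with its image under a suitable reflection in an
    eigenspace of [T^2], then over the reflections in the eigenspaces of [S],
    gives a matrix [Z] different from [log S] that commutes with [S], has no
    larger norm, and differs from [log S] by something trace-orthogonal to the
    common commutant of [S] and [T^2] ([pinching]).  By strict convexity the
    norm decreases at a linear rate from [log S] towards the midpoint of
    [log S] and [Z] ([descent_direction]).  Orthogonality to that commutant is exactly
    the condition under which [S W], with [W] the direction of descent, is
    tangent to the set of the conjugates of all the [T C T], for [C] in the
    orbit ([solve_skew], a duality argument).  Following unitary curves with
    the right velocities, [log S] moves along [W] up to an error of second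
    order, because the logarithm is Lipschitz on positive definite matrices
    with bounded inverses ([mxlog_lip]).

    Second-order moves put the eigenvalues in order ([local_min_ordered]).  In
    a common eigenbasis [S] has the eigenvalues [c_i / a_i].  If [a_i > a_j]
    but [c_i < c_j], a small rotation of [C0] in the plane of the two
    eigenvectors preserves the product of the two eigenvalues of [S] concerned
    and decreases their sum.  Their logarithms become strict convex
    combinations of the old ones and the old ones exchanged, and the norm
    decreases.

    Hence the matrices are diagonal in a common orthonormal basis with both
    lists of eigenvalues non-increasing ([local_min_aligned]), and the value at
    [C0] only depends on the eigenvalues of [A] and [B].  Since the unitary
    group is compact, a global minimizer exists ([orbit_min]); it is also a
    local one, so it has that same value, and [C0] is a global minimizer
    ([local_min_global]). *)

(** * Selfadjoint matrices and functional calculus *)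

(** An algebraically closed field with conjugation whose real elements are the
    copy [rc] of the reals: the complex numbers, kept abstract so that no
    computation with pairs of reals ever takes place. *)
Record complexField (R : realType) := ComplexField {
  cfsort :> numClosedFieldType;
  rc : {rmorphism R -> cfsort};
  re : cfsort -> R;
  ler_rc : forall x y, (rc x <= rc y) = (x <= y);
  reK : forall z, z \is Num.real -> rc (re z) = z }.
Arguments rc {R c}.
Arguments re {R c} z.
Arguments ler_rc {R} c x y.

Section Adjoint.
Variables (R : realType) (C : complexField R).

Lemma rc_inj : injective (rc : R -> C).
Proof. by move=> x y e; apply/eqP; rewrite eq_le -!(ler_rc C) e lexx. Qed.

Lemma rc_real (t : R) : (rc t : C) \is Num.real.
Proof. by rewrite realE -(rmorph0 rc) !ler_rc -realE num_real. Qed.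

Lemma rcK (t : R) : re (rc t : C) = t.
Proof. by apply: rc_inj; rewrite reK ?rc_real. Qed.

Lemma ltr_rc x y : ((rc x : C) < rc y) = (x < y).
Proof. by rewrite !lt_neqAle ler_rc (inj_eq rc_inj). Qed.

Lemma ler0_rc x : (0 <= (rc x : C)) = (0 <= x).
Proof. by rewrite -(ler_rc C) rmorph0. Qed.

Lemma ltr0_rc x : (0 < (rc x : C)) = (0 < x).
Proof. by rewrite -ltr_rc rmorph0. Qed.

Lemma conj_rc (t : R) : (rc t : C)^* = rc t.
Proof. exact/CrealP/rc_real. Qed.

Lemma adjmxM m n p (X : 'M[C]_(m, n)) (Y : 'M[C]_(n, p)) :
  (X *m Y)^t* = Y^t* *m X^t*.
Proof. by rewrite trmx_mul map_mxM. Qed.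

Lemma adjmxD m n (X Y : 'M[C]_(m, n)) : (X + Y)^t* = X^t* + Y^t*.
Proof. by rewrite linearD map_mxD. Qed.

Lemma adjmxN m n (X : 'M[C]_(m, n)) : (- X)^t* = - X^t*.
Proof. by rewrite linearN map_mxN. Qed.

Lemma adjmxB m n (X Y : 'M[C]_(m, n)) : (X - Y)^t* = X^t* - Y^t*.
Proof. by rewrite adjmxD adjmxN. Qed.

Lemma adjmxZ m n (t : R) (X : 'M[C]_(m, n)) : (rc t *: X)^t* = rc t *: X^t*.
Proof. by rewrite linearZ /= map_mxZ; congr (_ *: _); exact: conj_rc. Qed.

Lemma adjmx1 n : (1%:M : 'M[C]_n)^t* = 1%:M.
Proof. by rewrite trmx1 map_mx1. Qed.

Variable d : nat.
Implicit Types (U V H X Y : 'M[C]_d) (a b : 'rV[R]_d).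

Definition rdiag a : 'M[C]_d := diag_mx (map_mx rc a).

(** A selfadjoint matrix given by an orthonormal eigenbasis (the columns
    of [U^t*]) and its real eigenvalues. *)
Definition udiag U a : 'M[C]_d := U^t* *m rdiag a *m U.

Definition fcalc (f : R -> R) H : 'M[C]_d :=
  invmx (spectralmx H) *m rdiag (\row_j f (re (spectral_diag H 0 j)))
    *m spectralmx H.

Lemma hermmxP H : (H \is hermsymmx) <-> H^t* = H.
Proof.
split; first by move/is_hermitianmxP; rewrite expr0 scale1r => {2}->.
by move=> e; apply/is_hermitianmxP; rewrite expr0 scale1r e.
Qed.

Lemma unitaryl U : U \is unitarymx -> U *m U^t* = 1%:M.
Proof. by move/unitarymxP. Qed.

Lemma unitaryr U : U \is unitarymx -> U^t* *m U = 1%:M.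
Proof. by move=> /unitarymxP; apply: mulmx1C. Qed.

Lemma unitKr U p (X : 'M[C]_(d, p)) : U \is unitarymx -> U *m U^t* *m X = X.
Proof. by move=> hU; rewrite (unitaryl hU) mul1mx. Qed.

Lemma unitKl U p (X : 'M[C]_(d, p)) : U \is unitarymx -> U^t* *m U *m X = X.
Proof. by move=> hU; rewrite (unitaryr hU) mul1mx. Qed.

Lemma adj_unitary U : U \is unitarymx -> U^t* \is unitarymx.
Proof. by rewrite trmxC_unitary. Qed.

Lemma unitary1 : (1%:M : 'M[C]_d) \is unitarymx.
Proof. by apply/unitarymxP; rewrite adjmx1 mulmx1. Qed.

Lemma rdiagE a i j : rdiag a i j = rc (a 0 i) *+ (i == j).
Proof. by rewrite !mxE. Qed.

Lemma mul_rdiagE a p (X : 'M[C]_(d, p)) i j :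
  (rdiag a *m X) i j = rc (a 0 i) * X i j.
Proof. by rewrite /rdiag mul_diag_mx !mxE. Qed.

Lemma mul_mx_rdiagE a X i j : (X *m rdiag a) i j = X i j * rc (a 0 j).
Proof. by rewrite /rdiag mul_mx_diag !mxE. Qed.

Lemma adjE m n (X : 'M[C]_(m, n)) i j : X^t* i j = (X j i)^*%R.
Proof. by rewrite !mxE. Qed.

Lemma mulE m n p (X : 'M[C]_(m, n)) (Y : 'M[C]_(n, p)) i j :
  (X *m Y) i j = \sum_k X i k * Y k j.
Proof. by rewrite mxE. Qed.

Lemma mapE (f : R -> R) a i : map_mx f a 0 i = f (a 0 i).
Proof. by rewrite mxE. Qed.

Lemma rdiag_mul a b : rdiag a *m rdiag b = rdiag (\row_i (a 0 i * b 0 i)).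
Proof.
rewrite /rdiag mulmx_diag; congr diag_mx.
by apply/rowP=> i; rewrite !mxE rmorphM.
Qed.

Lemma rdiag_add a b : rdiag a + rdiag b = rdiag (a + b).
Proof. by apply/matrixP=> i j; rewrite !mxE -mulrnDl rmorphD. Qed.

Lemma rdiagZ t a : rc t *: rdiag a = rdiag (t *: a).
Proof. by apply/matrixP=> i j; rewrite !mxE rmorphM mulrnAr. Qed.

Lemma rdiag_inj : injective rdiag.
Proof.
move=> a b e; apply/rowP=> i; have /matrixP/(_ i i) := e.
by rewrite !rdiagE eqxx !mulr1n; apply: rc_inj.
Qed.

Lemma rdiag_adj a : (rdiag a)^t* = rdiag a.
Proof.
apply/matrixP=> i j; rewrite !mxE eq_sym.
by case: eqP => [->|_]; rewrite ?mulr0n ?mulr1n ?conj_rc ?conjC0.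
Qed.

Lemma rdiag_const t : rdiag (const_mx t) = rc t *: (1%:M : 'M[C]_d).
Proof. by apply/matrixP=> i j; rewrite !mxE mulr_natr. Qed.

Lemma udiag_adj U a : (udiag U a)^t* = udiag U a.
Proof. by rewrite /udiag !adjmxM rdiag_adj trmxCK mulmxA. Qed.

Lemma udiagD U a b : udiag U a + udiag U b = udiag U (a + b).
Proof. by rewrite /udiag -mulmxDl -mulmxDr rdiag_add. Qed.

Lemma udiagZ U t a : rc t *: udiag U a = udiag U (t *: a).
Proof. by rewrite /udiag -rdiagZ -scalemxAr -scalemxAl. Qed.

Lemma udiagM U a b : U \is unitarymx ->
  udiag U a *m udiag U b = udiag U (\row_i (a 0 i * b 0 i)).
Proof.
move=> hU; rewrite /udiag -rdiag_mul !mulmxA.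
by rewrite (mulmxtVK _ hU).
Qed.

Lemma udiagC U a b : U \is unitarymx ->
  udiag U a *m udiag U b = udiag U b *m udiag U a.
Proof.
move=> hU; rewrite (udiagM a b hU) (udiagM b a hU); apply: (congr1 (udiag U)).
by apply/rowP=> i; rewrite !mxE mulrC.
Qed.

Lemma udiag1 U : U \is unitarymx -> udiag U (const_mx 1) = 1%:M.
Proof. by move=> hU; rewrite /udiag rdiag_const rmorph1 scale1r mulmx1 (unitaryr hU). Qed.

Lemma udiag_conj U V a : V^t* *m udiag U a *m V = udiag (U *m V) a.
Proof. by rewrite /udiag adjmxM !mulmxA. Qed.

Lemma udiag_diag U a : U \is unitarymx -> U *m udiag U a *m U^t* = rdiag a.
Proof.
by move=> hU; rewrite /udiag !mulmxA (unitKr _ hU) (mulmxtVK _ hU).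
Qed.

(** In mixed eigenbases, where [X] becomes [Y = U X V^*], the relation reads
    [(a_i - b_j) Y_ij = 0]. *)
Lemma intertwineP U V a b X : U \is unitarymx -> V \is unitarymx ->
  udiag U a *m X = X *m udiag V b <->
  (forall i j, a 0 i != b 0 j -> (U *m X *m V^t*) i j = 0).
Proof.
move=> hU hV; set Y := U *m X *m V^t*.
have key : udiag U a *m X = X *m udiag V b <-> rdiag a *m Y = Y *m rdiag b.
  rewrite /udiag /Y; split=> e.
    have := congr1 (fun M => U *m M *m V^t*) e.
    by rewrite /= !mulmxA (unitKr _ hU) (mulmxtVK _ hV).
  have := congr1 (fun M => U^t* *m M *m V) e.
  by rewrite /= !mulmxA (unitKl _ hU) (mulmxKtV _ hV erefl).
apply: (iff_trans key); split=> [/matrixP h i j ab|h].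
  have := h i j; rewrite mul_rdiagE mul_mx_rdiagE => e.
  apply/eqP; move/eqP: e.
  rewrite [X in _ == X]mulrC -subr_eq0 -mulrBl mulf_eq0.
  by rewrite subr_eq0 (inj_eq rc_inj) (negPf ab).
apply/matrixP=> i j; rewrite mul_rdiagE mul_mx_rdiagE.
have [->|/h ->] := eqVneq (a 0 i) (b 0 j); first by rewrite mulrC.
by rewrite mulr0 mul0r.
Qed.

(** A function can only identify more eigenvalues, which enlarges the support
    allowed by [intertwineP].  This makes the functional calculus independent of
    the eigenbasis and compatible with commutation. *)
Lemma intertwine_fun (f : R -> R) U V a b X :
  U \is unitarymx -> V \is unitarymx ->
  udiag U a *m X = X *m udiag V b ->
  udiag U (map_mx f a) *m X = X *m udiag V (map_mx f b).
Proof.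
move=> hU hV /(intertwineP _ _ _ hU hV) h; apply/(intertwineP _ _ _ hU hV).
by move=> i j; rewrite !mapE => ab; apply: h; apply: contraNneq ab => ->.
Qed.

Lemma comm_fun (f : R -> R) U a X : U \is unitarymx ->
  udiag U a *m X = X *m udiag U a ->
  udiag U (map_mx f a) *m X = X *m udiag U (map_mx f a).
Proof. by move=> hU; apply: intertwine_fun. Qed.

Lemma udiag_fun_eq (f : R -> R) U V a b : U \is unitarymx -> V \is unitarymx ->
  udiag U a = udiag V b -> udiag U (map_mx f a) = udiag V (map_mx f b).
Proof.
move=> hU hV e; have := @intertwine_fun f U V a b 1%:M hU hV.
rewrite (mulmx1 (udiag U a)) (mul1mx (udiag V b)) => /(_ e).
by rewrite (mulmx1 (udiag U _)) (mul1mx (udiag V _)).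
Qed.

Lemma herm_udiag H : H^t* = H ->
  H = udiag (spectralmx H) (\row_j re (spectral_diag H 0 j)).
Proof.
move/hermmxP => hH; have /orthomx_spectralP := hermitian_normalmx hH.
have /mxOverP := hermitian_spectral_diag_real hH.
have := spectral_unitarymx H.
move: (spectralmx H) (spectral_diag H) => V s hV hs e.
rewrite {1}e (invmx_unitary hV) /udiag.
suff -> : diag_mx s = rdiag (\row_j re (s 0 j)) by [].
apply/matrixP=> i j; rewrite !mxE.
by rewrite reK.
Qed.

Lemma fcalc_udiag (f : R -> R) U a : U \is unitarymx ->
  fcalc f (udiag U a) = udiag U (map_mx f a).
Proof.
move=> hU; set H := udiag U a.
have e : H = _ := herm_udiag (udiag_adj U a).
have hV := spectral_unitarymx H.
move: e hV; rewrite /fcalc.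
move: (spectralmx H) (spectral_diag H) => V s e hV.
rewrite (udiag_fun_eq f hU hV e) (invmx_unitary hV) /udiag.
suff -> : map_mx f (\row_j re (s 0 j)) =
          \row_j f (re (s 0 j)) by [].
by apply/rowP=> j; rewrite mapE !mxE.
Qed.

Lemma herm_ex H : H^t* = H -> exists U a, U \is unitarymx /\ H = udiag U a.
Proof.
move=> hH; exists (spectralmx H), (\row_j re (spectral_diag H 0 j)).
by split; [exact: spectral_unitarymx | exact: herm_udiag].
Qed.

Lemma fcalc_conj (f : R -> R) V H : V \is unitarymx -> H^t* = H ->
  fcalc f (V^t* *m H *m V) = V^t* *m fcalc f H *m V.
Proof.
move=> hV /herm_ex [U [a [hU ->]]].
by rewrite udiag_conj (fcalc_udiag f a hU) (fcalc_udiag f a (mul_unitarymx hU hV)) udiag_conj.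
Qed.

(** Commuting selfadjoint matrices are triangular in a common orthonormal
    basis, hence diagonal there. *)
Lemma simdiag H X : H^t* = H -> X^t* = X -> H *m X = X *m H ->
  exists U a b, [/\ U \is unitarymx, H = udiag U a & X = udiag U b].
Proof.
move=> hH hX /cotrigonalization2 [P hP /andP[tH tX]].
have red (Z : 'M[C]_d) : Z^t* = Z -> similar_trig P Z ->
    exists a, Z = udiag P a.
  move=> hZ /is_trig_mxP tZ.
  have {}tZ (i j : 'I_d) : (i < j)%N -> (P *m Z *m P^t*) i j = 0.
    by move=> lt; rewrite -(conjymx _ hP) tZ.
  set Y := P *m Z *m P^t* in tZ.
  have hY : Y^t* = Y by rewrite /Y !adjmxM trmxCK hZ mulmxA.
  have sw i j : Y i j = (Y j i)^*%R by rewrite -{1}hY adjE.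
  exists (\row_i re (Y i i)).
  have -> : Z = P^t* *m Y *m P.
    by rewrite /Y !mulmxA (unitKl _ hP) (mulmxKtV _ hP erefl).
  rewrite /udiag; congr (_ *m _ *m _); apply/matrixP=> i j; rewrite rdiagE mxE.
  have [->|ij] := eqVneq i j.
    rewrite mulr1n reK //; apply/CrealP; apply: esym; exact: sw.
  rewrite mulr0n; case: (ltngtP i j) => [/tZ //|/tZ|/val_inj e].
    by move=> e; rewrite sw e conjC0.
  by rewrite e eqxx in ij.
have [a ea] := red _ hH tH; have [b eb] := red _ hX tX.
by exists P, a, b.
Qed.

End Adjoint.

(** * The entrywise norm *)

Section EntryNorm.
Variables (R : realType) (C : complexField R).

Definition cabs (z : C) : R := re `|z|.

Lemma rc_cabs z : rc (cabs z) = `|z|.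
Proof. by rewrite reK ?normr_real. Qed.

Lemma cabs_ge0 z : 0 <= cabs z.
Proof. by rewrite -(ler_rc C) rmorph0 rc_cabs. Qed.

Lemma cabsD x y : cabs (x + y) <= cabs x + cabs y.
Proof. by rewrite -(ler_rc C) rmorphD !rc_cabs ler_normD. Qed.

Lemma cabsM x y : cabs (x * y) = cabs x * cabs y.
Proof. by apply: (@rc_inj _ C); rewrite rmorphM !rc_cabs normrM. Qed.

Lemma cabsN x : cabs (- x) = cabs x.
Proof. by rewrite /cabs normrN. Qed.

Lemma cabs0 : cabs 0 = 0.
Proof. by apply: (@rc_inj _ C); rewrite rc_cabs normr0 rmorph0. Qed.

Lemma cabs_conj x : cabs (x^*) = cabs x.
Proof. by rewrite /cabs norm_conjC. Qed.

Lemma cabs_rc (x : R) : cabs (rc x) = `|x|.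
Proof.
apply: (@rc_inj _ C); rewrite rc_cabs.
have [x0|x0] := lerP 0 x; first by rewrite !ger0_norm ?ler0_rc.
by rewrite (ltr0_norm x0) -normrN -rmorphN ger0_norm // ler0_rc oppr_ge0 ltW.
Qed.

Lemma cabs_sum I (r : seq I) (P : pred I) (F : I -> C) :
  cabs (\sum_(i <- r | P i) F i) <= \sum_(i <- r | P i) cabs (F i).
Proof.
apply: (big_ind2 (fun x y => cabs x <= y)) => //; first by rewrite cabs0.
by move=> x1 y1 x2 y2 h1 h2; apply: le_trans (cabsD _ _) (lerD h1 h2).
Qed.

Variable d : nat.
Implicit Types (U V H X Y : 'M[C]_d) (a b : 'rV[R]_d).

(** Any norm would do for the estimates; this one is submultiplicative for
    trivial reasons. *)
Definition l1norm X : R := \sum_i \sum_j cabs (X i j).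

Lemma l1norm_ge0 X : 0 <= l1norm X.
Proof. by apply: sumr_ge0 => i _; apply: sumr_ge0 => j _; apply: cabs_ge0. Qed.

Lemma cabs_le_l1norm X i j : cabs (X i j) <= l1norm X.
Proof.
rewrite /l1norm (bigD1 i) //= (bigD1 j) //= -addrA lerDl addr_ge0 //.
  by apply: sumr_ge0 => k _; apply: cabs_ge0.
by apply: sumr_ge0 => k _; apply: sumr_ge0 => l _; apply: cabs_ge0.
Qed.

Lemma l1normD X Y : l1norm (X + Y) <= l1norm X + l1norm Y.
Proof.
rewrite /l1norm -big_split; apply: ler_sum => i _ /=; rewrite -big_split.
by apply: ler_sum => j _ /=; rewrite mxE cabsD.
Qed.

Lemma l1normN X : l1norm (- X) = l1norm X.
Proof.
by apply: eq_bigr => i _; apply: eq_bigr => j _; rewrite mxE cabsN.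
Qed.

Lemma l1norm_distC X Y : l1norm (X - Y) = l1norm (Y - X).
Proof. by rewrite -l1normN opprB. Qed.

Lemma l1normZ c X : l1norm (c *: X) = cabs c * l1norm X.
Proof.
rewrite /l1norm mulr_sumr; apply: eq_bigr => i _.
by rewrite mulr_sumr; apply: eq_bigr => j _; rewrite mxE cabsM.
Qed.

Lemma l1normM X Y : l1norm (X *m Y) <= l1norm X * l1norm Y.
Proof.
rewrite /l1norm mulr_suml; apply: ler_sum => i _.
apply: (@le_trans _ _ (\sum_j \sum_k cabs (X i k) * cabs (Y k j))).
  apply: ler_sum => j _; rewrite mulE; apply: le_trans (cabs_sum _ _ _) _.
  by apply: ler_sum => k _; rewrite cabsM.
rewrite exchange_big /= mulr_suml; apply: ler_sum => k _.
rewrite -mulr_sumr ler_wpM2l ?cabs_ge0 //.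
rewrite [leRHS](bigD1 k) //= lerDl; apply: sumr_ge0 => l _.
by apply: sumr_ge0 => j _; apply: cabs_ge0.
Qed.

Lemma l1norm_adj X : l1norm (X^t*) = l1norm X.
Proof.
rewrite /l1norm exchange_big /=; apply: eq_bigr => i _; apply: eq_bigr => j _.
by rewrite adjE cabs_conj.
Qed.

Lemma cabs_unitary U i j : U \is unitarymx -> cabs (U i j) <= 1.
Proof.
move=> /unitaryl /matrixP/(_ i i); rewrite mulE mxE eqxx mulr1n => h.
rewrite -(@expr_le1 _ 2) ?cabs_ge0 //.
rewrite -(ler_rc C) rmorphXn rmorph1 /= rc_cabs normCK -{}h.
rewrite (bigD1 j) //= adjE lerDl; apply: sumr_ge0 => k _.
by rewrite adjE mul_conjC_ge0.
Qed.

(** The bound for [l1norm] on unitary matrices. *)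
Definition sqdim : R := (d * d)%:R.

Lemma sqdim_ge0 : 0 <= sqdim. Proof. exact: ler0n. Qed.

Lemma l1norm_unitary U : U \is unitarymx -> l1norm U <= sqdim.
Proof.
move=> hU; apply: (@le_trans _ _ (\sum_(i < d) \sum_(j < d) 1)).
  by apply: ler_sum => i _; apply: ler_sum => j _; apply: cabs_unitary.
by rewrite !big_const_ord !iter_addr_0 -mulrnA.
Qed.

Lemma l1norm_mul3 X Y H : l1norm (X *m Y *m H) <= l1norm X * l1norm Y * l1norm H.
Proof.
by apply: le_trans (l1normM _ _) _; rewrite ler_wpM2r ?l1norm_ge0 // l1normM.
Qed.

Lemma l1norm_sandwich U V X : U \is unitarymx -> V \is unitarymx ->
  l1norm (U *m X *m V) <= sqdim ^+ 2 * l1norm X.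
Proof.
move=> hU hV; apply: le_trans (l1norm_mul3 _ _ _) _.
rewrite mulrAC expr2 ler_wpM2r ?l1norm_ge0 //.
by rewrite ler_pM ?l1norm_ge0 // l1norm_unitary.
Qed.

Lemma subE X Y i j : (X - Y) i j = X i j - Y i j.
Proof. by rewrite !mxE. Qed.

(** In mixed eigenbases the entries of the two differences are those of [U V^*]
    multiplied by [f a_i - f b_j] and by [a_i - b_j]. *)
Lemma udiag_lip (f : R -> R) k U V a b : U \is unitarymx -> V \is unitarymx ->
  0 <= k -> (forall i j, `|f (a 0 i) - f (b 0 j)| <= k * `|a 0 i - b 0 j|) ->
  l1norm (udiag U (map_mx f a) - udiag V (map_mx f b)) <=
    sqdim ^+ 4 * k * l1norm (udiag U a - udiag V b).
Proof.
move=> hU hV k0 hk; pose M := U *m V^t*.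
have mixed (x y : 'rV[R]_d) :
    U *m (udiag U x - udiag V y) *m V^t* = rdiag C x *m M - M *m rdiag C y.
  rewrite mulmxBr mulmxBl /udiag /M !mulmxA (unitKr _ hU).
  by rewrite (mulmxtVK _ hV).
have back Z : Z = U^t* *m (U *m Z *m V^t*) *m V.
  by rewrite !mulmxA (unitKl _ hU) (mulmxKtV _ hV erefl).
have ent (x y : 'rV[R]_d) i j :
    (rdiag C x *m M - M *m rdiag C y) i j = rc (x 0 i - y 0 j) * M i j.
  by rewrite subE mul_rdiagE mul_mx_rdiagE rmorphB mulrBl [M i j * _]mulrC.
have k_mul (x y : 'rV[R]_d) : l1norm (udiag U x - udiag V y) <=
    sqdim ^+ 2 * l1norm (rdiag C x *m M - M *m rdiag C y).
  by rewrite {1}(back (_ - _)) mixed l1norm_sandwich // adj_unitary.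
apply: le_trans (k_mul _ _) _.
have -> : sqdim ^+ 4 * k * l1norm (udiag U a - udiag V b) =
    sqdim ^+ 2 * (k * (sqdim ^+ 2 * l1norm (udiag U a - udiag V b))) by ring.
rewrite ler_wpM2l ?exprn_ge0 ?sqdim_ge0 //.
apply: (@le_trans _ _ (k * l1norm (rdiag C a *m M - M *m rdiag C b))).
  rewrite /l1norm [leRHS]mulr_sumr; apply: ler_sum => i _.
  rewrite [leRHS]mulr_sumr; apply: ler_sum => j _; rewrite !ent !cabsM !cabs_rc mulrA.
  by rewrite ler_wpM2r ?cabs_ge0 // !mapE.
rewrite ler_wpM2l // -mixed.
by rewrite l1norm_sandwich // adj_unitary.
Qed.

End EntryNorm.

(** * Scalar estimates for the logarithm *)

Section Logarithm.
Variable R : realType.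

Lemma ln_le_sub1 (x : R) : 0 < x -> ln x <= x - 1.
Proof.
by move=> x0; rewrite -{1}(subrK 1 x) addrC le_ln1Dx // ltrBrDr addNr.
Qed.

Lemma ln_diff (a b : R) : 0 < a -> 0 < b ->
  `|ln a - ln b| <= (a^-1 + b^-1) * `|a - b|.
Proof.
have half (x y : R) : 0 < x -> 0 < y ->
    ln x - ln y <= (x^-1 + y^-1) * `|x - y|.
  move=> x0 y0; rewrite -ln_div ?posrE //.
  apply: le_trans (ln_le_sub1 (divr_gt0 x0 y0)) _.
  have -> : x / y - 1 = y^-1 * (x - y) by field; rewrite gt_eqF.
  apply: (@le_trans _ _ (y^-1 * `|x - y|)).
    by rewrite ler_wpM2l ?ler_norm // invr_ge0 ltW.
  by rewrite ler_wpM2r // lerDr invr_ge0 ltW.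
move=> a0 b0; rewrite ler_norml half // andbT lerNl opprB distrC [a^-1 + _]addrC.
exact: half.
Qed.

(** Both bounds are [ln x <= x - 1], the lower one at [1 / (1 + u)]. *)
Lemma ln1_bound (u : R) : `|u| <= 2^-1 -> `|ln (1 + u) - u| <= 2 * u ^+ 2.
Proof.
rewrite ler_norml => /andP[ul uu].
have u1 : 0 < 1 + u by lra.
have h1 : ln (1 + u) <= u by apply: le_ln1Dx; lra.
have h2 : u / (1 + u) <= ln (1 + u).
  have := ln_le_sub1 (x := (1 + u)^-1); rewrite invr_gt0 => /(_ u1).
  rewrite lnV ?posrE // => h.
  have -> : u / (1 + u) = 1 - (1 + u)^-1 by field; rewrite gt_eqF.
  lra.
have h3 : u - u / (1 + u) <= 2 * u ^+ 2.
  have -> : u - u / (1 + u) = u ^+ 2 * (1 + u)^-1 by field; rewrite gt_eqF.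
  rewrite mulrC ler_wpM2r ?sqr_ge0 // -[leRHS]invrK lef_pV2 ?posrE //; lra.
have u2 : 0 <= 2 * u ^+ 2 by rewrite mulr_ge0 ?sqr_ge0.
rewrite ler_norml; apply/andP; split; lra.
Qed.
End Logarithm.

(** * Positive definite matrices and their logarithms *)

Section PositiveDefinite.
Variables (R : realType) (C : complexField R) (d : nat).
Implicit Types (U V H X Y T G : 'M[C]_d) (a b : 'rV[R]_d).

Definition pd H := H^t* = H /\
  forall v : 'cV[C]_d, v != 0 -> 0 < (v^t* *m H *m v) 0 0.

(** The eigenvalue [a 0 i] is the value of the quadratic form at its unit
    eigenvector. *)
Lemma pd_udiag_gt0 U a i : U \is unitarymx -> pd (udiag U a) -> 0 < a 0 i.
Proof.
move=> hU [_ pH]; pose e : 'cV[C]_d := delta_mx i 0; pose v := U^t* *m e.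
have Uv : U *m v = e by rewrite /v mulmxA (unitKr _ hU).
have v0 : v != 0.
  apply/eqP=> v0; have /matrixP/(_ i 0) := Uv.
  by rewrite v0 mulmx0 !mxE !eqxx => /esym /eqP; rewrite oner_eq0.
have := pH v v0; rewrite /udiag.
have -> : v^t* *m (U^t* *m rdiag C a *m U) *m v =
    (U *m v)^t* *m (rdiag C a *m (U *m v)) by rewrite adjmxM !mulmxA.
rewrite Uv mulE (bigD1 i) //= big1 ?addr0.
  by rewrite mul_rdiagE adjE !mxE !eqxx mulr1 conjC1 mul1r ltr0_rc.
by move=> k /negPf ki; rewrite adjE !mxE ki conjC0 mul0r.
Qed.

Lemma pd_udiag H : pd H ->
  exists U a, [/\ U \is unitarymx, forall i, 0 < a 0 i & H = udiag U a].
Proof.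
move=> pH; have [U [a [hU eH]]] := herm_ex pH.1.
by exists U, a; split=> // i; rewrite eH in pH; apply: pd_udiag_gt0 hU pH.
Qed.

Lemma pd_sandwich H T : T \in unitmx -> pd H -> pd (T^t* *m H *m T).
Proof.
move=> hT [hH pH]; split; first by rewrite !adjmxM trmxCK hH mulmxA.
move=> v v0; have Tv : T *m v != 0.
  apply: contraNneq v0 => /(congr1 (mulmx (invmx T))).
  by rewrite mulmxA mulVmx // mul1mx mulmx0 => ->.
by have := pH _ Tv; rewrite adjmxM !mulmxA.
Qed.

Lemma udiag_inv U a : U \is unitarymx -> (forall i, 0 < a 0 i) ->
  udiag U a *m udiag U (map_mx (fun x => x^-1) a) = 1%:M.
Proof.
move=> hU a0; rewrite udiagM // -(udiag1 hU); congr udiag.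
by apply/rowP=> i; rewrite !mxE divff // gt_eqF.
Qed.

(** The reciprocal eigenvalues are diagonal entries of the inverse, so that a
    bound on the inverse keeps the eigenvalues away from [0]. *)
Lemma udiag_inv_bound U a G i : U \is unitarymx -> (forall i, 0 < a 0 i) ->
  udiag U a *m G = 1%:M -> (a 0 i)^-1 <= sqdim R d ^+ 2 * l1norm G.
Proof.
move=> hU a0 /(congr1 (mulmx (udiag U (map_mx (fun x => x^-1) a)))).
rewrite mulmxA (udiagC _ _ hU) (udiag_inv hU a0) mul1mx mulmx1 => eG.
apply: le_trans (l1norm_sandwich G hU (adj_unitary hU)).
apply: le_trans (cabs_le_l1norm _ i i).
rewrite eG (udiag_diag _ hU) rdiagE eqxx mulr1n mapE cabs_rc ger0_norm //.
by rewrite invr_ge0 ltW.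
Qed.

Definition mxlog H : 'M[C]_d := fcalc (@ln R) H.

Lemma mxlog_udiag U a : U \is unitarymx ->
  mxlog (udiag U a) = udiag U (map_mx (@ln R) a).
Proof. exact: fcalc_udiag. Qed.

(** The logarithm is Lipschitz away from [0]; the inverses [X'] and [Y'] measure
    how far away the spectra are. *)
Lemma mxlog_lip X Y X' Y' k : pd X -> pd Y ->
  X *m X' = 1%:M -> Y *m Y' = 1%:M -> l1norm X' <= k -> l1norm Y' <= k ->
  l1norm (mxlog X - mxlog Y) <=
    sqdim R d ^+ 4 * (sqdim R d ^+ 2 * k *+ 2) * l1norm (X - Y).
Proof.
move=> /pd_udiag [U [a [hU a0 ->]]] /pd_udiag [V [b [hV b0 ->]]] eX eY kX kY.
have k0 : 0 <= k by apply: le_trans kX; apply: l1norm_ge0.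
rewrite !mxlog_udiag //; apply: udiag_lip => // [|i j].
  by rewrite mulrn_wge0 // mulr_ge0 // exprn_ge0 // sqdim_ge0.
apply: le_trans (ln_diff _ _) _ => //; rewrite ler_wpM2r // mulr2n lerD //.
  apply: le_trans (udiag_inv_bound i hU a0 eX) _.
  by rewrite ler_wpM2l // exprn_ge0 // sqdim_ge0.
apply: le_trans (udiag_inv_bound j hV b0 eY) _.
by rewrite ler_wpM2l // exprn_ge0 // sqdim_ge0.
Qed.

End PositiveDefinite.

(** * Unitarily invariant norms *)

Section UINorm.
Variables (R : realType) (C : complexField R) (d : nat).
Implicit Types (U V H X Y T G : 'M[C]_d) (a b : 'rV[R]_d).
Implicit Types (N : 'M[C]_d -> R).

(** Strict convexity concerns the real diagonal matrices, the diagonal forms of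
    the selfadjoint ones. *)
Record uinorm N : Prop := UINorm {
  un_tri : forall X Y, N (X + Y) <= N X + N Y;
  un_hom : forall c X, N (c *: X) = cabs c * N X;
  un_def : forall X, N X = 0 -> X = 0;
  un_inv : forall X U V, U \is unitarymx -> V \is unitarymx ->
    N (U *m X *m V) = N X;
  un_sc : forall a b, N (rdiag C a) = 1 -> N (rdiag C b) = 1 -> a != b ->
    forall t, 0 < t -> t < 1 ->
    N (rc t *: rdiag C a + rc (1 - t) *: rdiag C b) < 1 }.

Variables (N : 'M[C]_d -> R) (hN : uinorm N).

Lemma un0 : N 0 = 0.
Proof. by rewrite -(scale0r 0) (un_hom hN) cabs0 mul0r. Qed.

Lemma unN X : N (- X) = N X.
Proof.
by rewrite -scaleN1r (un_hom hN) cabsN -(rmorph1 rc) cabs_rc normr1 mul1r.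
Qed.

Lemma un_ge0 X : 0 <= N X.
Proof.
have := un_tri hN X (- X); rewrite subrr un0 unN => h; lra.
Qed.

Lemma un_rcZ t X : 0 <= t -> N (rc t *: X) = t * N X.
Proof. by move=> t0; rewrite (un_hom hN) cabs_rc ger0_norm. Qed.

Lemma un_conj U X : U \is unitarymx -> N (U^t* *m X *m U) = N X.
Proof. by move=> hU; rewrite (un_inv hN) // adj_unitary. Qed.

Lemma un_udiag U a : U \is unitarymx -> N (udiag U a) = N (rdiag C a).
Proof. exact: un_conj. Qed.

Lemma un_sum I (r : seq I) (F : I -> 'M[C]_d) :
  N (\sum_(i <- r) F i) <= \sum_(i <- r) N (F i).
Proof.
apply: (big_ind2 (fun x y => N x <= y)) => //; first by rewrite un0.
by move=> x1 y1 x2 y2 h1 h2; apply: le_trans (un_tri hN _ _) (lerD h1 h2).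
Qed.

Lemma un_bound : exists2 c, 0 <= c & forall X, N X <= c * l1norm X.
Proof.
exists (\sum_i \sum_j N (delta_mx i j)).
  by apply: sumr_ge0 => i _; apply: sumr_ge0 => j _; apply: un_ge0.
move=> X; rewrite {1}(matrix_sum_delta X).
apply: le_trans (un_sum _ _) _; rewrite mulr_suml; apply: ler_sum => i _.
apply: le_trans (un_sum _ _) _; rewrite mulr_suml; apply: ler_sum => j _.
by rewrite (un_hom hN) mulrC ler_wpM2l ?un_ge0 // cabs_le_l1norm.
Qed.

Lemma un_lip : exists2 c, 0 <= c & forall X Y, N X <= N Y + c * l1norm (X - Y).
Proof.
have [c c0 hc] := un_bound; exists c => // X Y.
rewrite -{1}(subrK Y X) addrC; apply: le_trans (un_tri hN _ _) _.
by rewrite lerD2l.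
Qed.

(** Rescaling to the unit sphere reduces the case of equal norms to strict
    convexity; if the norms differ, the triangle inequality suffices. *)
Lemma un_strict a b t : N (rdiag C a) <= N (rdiag C b) -> a != b ->
  0 < t -> t < 1 -> N (rdiag C (t *: a + (1 - t) *: b)) < N (rdiag C b).
Proof.
move=> le_ab ab t0 t1; rewrite -rdiag_add -!rdiagZ.
have s0 : 0 < 1 - t by lra.
have tri : N (rc t *: rdiag C a + rc (1 - t) *: rdiag C b) <=
    t * N (rdiag C a) + (1 - t) * N (rdiag C b).
  by apply: le_trans (un_tri hN _ _) _; rewrite !un_rcZ // ltW.
case: (ltgtP (N (rdiag C a)) (N (rdiag C b))) le_ab => // [lt_ab|e] _.
  by apply: le_lt_trans tri _; nra.
have [b0|b0] := eqVneq (N (rdiag C b)) 0.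
  case/eqP: ab; apply: (@rdiag_inj _ C).
  by rewrite (un_def hN b0) (un_def hN (etrans e b0)).
set n := N (rdiag C b) in e b0 *.
have n0 : 0 < n by rewrite lt_neqAle eq_sym b0 un_ge0.
have nV : 0 <= n^-1 by rewrite invr_ge0 ltW.
have na : N (rdiag C (n^-1 *: a)) = 1 by rewrite -rdiagZ un_rcZ // e mulVf.
have nb : N (rdiag C (n^-1 *: b)) = 1 by rewrite -rdiagZ un_rcZ // mulVf.
have nab : n^-1 *: a != n^-1 *: b.
  by rewrite (inj_eq (@scalerI _ _ n^-1 _)) // invr_eq0.
have := un_sc hN na nb nab t0 t1.
have -> : rc t *: rdiag C (n^-1 *: a) + rc (1 - t) *: rdiag C (n^-1 *: b) =
    rc n^-1 *: (rc t *: rdiag C a + rc (1 - t) *: rdiag C b).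
  rewrite !rdiagZ !rdiag_add rdiagZ scalerDr !scalerA.
  by rewrite [t * _]mulrC [(1 - t) * _]mulrC.
by rewrite un_rcZ // mulrC ltr_pdivrMr // mul1r.
Qed.

End UINorm.

(** * Averaging over reflections *)

Section Pinching.
Variables (R : realType) (C : complexField R) (d : nat).
Implicit Types (U V H X Y T G L S A Q Z : 'M[C]_d) (a b s : 'rV[R]_d).

(** The reflection that changes sign on the eigenspace of [a 0 i]. *)
Definition reflection U a i : 'M[C]_d :=
  udiag U (map_mx (fun x => if x == a 0 i then -1 else 1) a).

Lemma reflection_sq U a i : U \is unitarymx ->
  reflection U a i *m reflection U a i = 1%:M.
Proof.
move=> hU; rewrite udiagM // -(udiag1 hU); congr udiag.
by apply/rowP=> j; rewrite !mxE; case: ifP; rewrite ?mulrNN mulr1.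
Qed.

Lemma reflection_adj U a i : (reflection U a i)^t* = reflection U a i.
Proof. exact: udiag_adj. Qed.

Lemma reflection_unitary U a i : U \is unitarymx -> reflection U a i \is unitarymx.
Proof. by move=> hU; apply/unitarymxP; rewrite reflection_adj reflection_sq. Qed.

Lemma comm_reflectionP U a X : U \is unitarymx ->
  (forall i, reflection U a i *m X = X *m reflection U a i) <->
  udiag U a *m X = X *m udiag U a.
Proof.
move=> hU; split=> [h|h i]; last exact: comm_fun.
apply/(intertwineP _ _ _ hU hU) => k l kl.
have /(intertwineP _ _ _ hU hU) := h k; apply.
rewrite !mapE eqxx [a 0 l == _]eq_sym (negPf kl).
by rewrite lt_eqF //; lra.
Qed.

Definition average r X : 'M[C]_d := rc (2^-1) *: (X + r *m X *m r).

Lemma average_adj r X : r^t* = r -> X^t* = X -> (average r X)^t* = average r X.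
Proof. by move=> hr hX; rewrite /average adjmxZ adjmxD !adjmxM hr hX mulmxA. Qed.

Lemma average_comm r X : r *m r = 1%:M -> r *m average r X = average r X *m r.
Proof.
move=> rr; rewrite /average -scalemxAr -scalemxAl; congr (_ *: _).
rewrite mulmxDr mulmxDl addrC; congr (_ + _); last by rewrite -!mulmxA rr mulmx1.
by rewrite !mulmxA rr mul1mx.
Qed.

Lemma average_comm_other r q X : q *m r = r *m q -> q *m X = X *m q ->
  q *m average r X = average r X *m q.
Proof.
move=> qr qX; rewrite /average -scalemxAr -scalemxAl; congr (_ *: _).
rewrite mulmxDr mulmxDl qX; congr (_ + _).
by rewrite !mulmxA qr -(mulmxA r q) qX !mulmxA -(mulmxA _ q) qr !mulmxA.
Qed.

(** Averaging with [r i] forces commutation with [r i] and preserves the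
    commutation with the reflections treated before.  With the reflections of a
    selfadjoint matrix this is the pinching onto its commutant, and [P] collects
    what each step preserves. *)
Lemma average_all (I : eqType) (r : I -> 'M[C]_d) (P : 'M[C]_d -> Prop)
    (l : seq I) X :
  (forall i, r i *m r i = 1%:M) -> (forall i j, r i *m r j = r j *m r i) ->
  (forall i Y, P Y -> P (average (r i) Y)) -> P X ->
  exists Z, P Z /\ forall i, i \in l -> r i *m Z = Z *m r i.
Proof.
move=> rr rC hP PX; elim: l => [|i l [Z [PZ hZ]]]; first by exists X.
exists (average (r i) Z); split; first exact: hP.
move=> j; rewrite inE => /predU1P [->|/hZ jZ]; first exact: average_comm.
by apply: average_comm_other.
Qed.

(** The squared Frobenius norm. *)
Definition frosq X : C := \tr (X^t* *m X).

Lemma frosqE X : frosq X = \sum_i \sum_j `|X j i| ^+ 2.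
Proof.
apply: eq_bigr => i _; rewrite mulE; apply: eq_bigr => j _.
by rewrite adjE normCKC.
Qed.

Lemma frosq_ge0 X : 0 <= frosq X.
Proof.
by rewrite frosqE; apply: sumr_ge0 => i _; apply: sumr_ge0 => j _; rewrite exprn_ge0.
Qed.

Lemma frosq_eq0 X : frosq X = 0 -> X = 0.
Proof.
rewrite frosqE => /eqP; rewrite psumr_eq0; last first.
  by move=> i _; apply: sumr_ge0 => j _; rewrite exprn_ge0.
move=> /allP h; apply/matrixP=> j i; rewrite mxE.
have /implyP/(_ isT) := h i (mem_index_enum _).
rewrite psumr_eq0 => [/allP/(_ j (mem_index_enum _))/implyP/(_ isT)|k _].
  by rewrite expf_eq0 /= normr_eq0 => /eqP.
by rewrite exprn_ge0.
Qed.

Lemma frosq_conj r X : r^t* = r -> r *m r = 1%:M -> frosq (r *m X *m r) = frosq X.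
Proof.
move=> hr rr; rewrite /frosq !adjmxM hr !mulmxA -(mulmxA _ r r) rr mulmx1.
by rewrite mxtrace_mulC !mulmxA rr mul1mx.
Qed.

Lemma frosq_parallelogram X Y :
  frosq (X + Y) + frosq (X - Y) = (frosq X + frosq Y) *+ 2.
Proof.
rewrite /frosq adjmxD adjmxB !mulmxDl !mulmxDr !mulmxN !mulNmx.
rewrite !(mxtraceD, raddfN) /= ?(mxtraceD, raddfN) /=; ring.
Qed.

(** The parallelogram identity for [X] and its mirror image, which have the same
    Frobenius norm. *)
Lemma frosq_average r X : r^t* = r -> r *m r = 1%:M ->
  frosq X = frosq (average r X) + frosq (X - r *m X *m r) / 4%:R.
Proof.
move=> hr rr; have := frosq_parallelogram X (r *m X *m r).
rewrite frosq_conj // => e.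
have -> : frosq (average r X) = frosq (X + r *m X *m r) / 4%:R.
  rewrite /frosq /average adjmxZ -scalemxAl -scalemxAr scalerA mxtraceZ mulrC.
  rewrite -rmorphM; congr (_ * _); apply: (@mulfI _ 4%:R); first by rewrite pnatr_eq0.
  rewrite divff ?pnatr_eq0 // -(rmorph_nat rc) -rmorphM -(rmorph1 rc).
  by congr (rc _); field.
by rewrite -mulrDl e; field.
Qed.

Lemma frosq_average_le r X : r^t* = r -> r *m r = 1%:M ->
  frosq (average r X) <= frosq X.
Proof.
move=> hr rr; rewrite (frosq_average X hr rr) lerDl.
by rewrite divr_ge0 ?frosq_ge0.
Qed.

Lemma frosq_average_lt r X : r^t* = r -> r *m r = 1%:M -> r *m X != X *m r ->
  frosq (average r X) < frosq X.
Proof.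
move=> hr rr ne; rewrite lt_neqAle frosq_average_le // andbT.
apply: contraNneq ne => e; have := frosq_average X hr rr.
rewrite e -{1}[frosq X]addr0 => /addrI /esym/eqP.
rewrite mulf_eq0 invr_eq0 pnatr_eq0 orbF.
move=> /eqP/frosq_eq0/eqP; rewrite subr_eq0 => /eqP {1}->.
by rewrite !mulmxA rr mul1mx.
Qed.

End Pinching.

(** * A direction of strict decrease *)

Section Descent.
Variables (R : realType) (C : complexField R) (d : nat).
Variables (N : 'M[C]_d -> R) (hN : uinorm N).
Implicit Types (U V H X Y T G L S A Q Z : 'M[C]_d) (a b s : 'rV[R]_d).

Lemma un_average r X : r \is unitarymx -> r^t* = r -> N (average r X) <= N X.
Proof.
move=> ru hr; rewrite /average un_rcZ ?invr_ge0 ?ler0n //.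
have h1 := un_tri hN X (r *m X *m r).
have h2 : N (r *m X *m r) = N X by rewrite (un_inv hN).
lra.
Qed.

Lemma rc_half (x : C) : rc 2^-1 * (x + x) = x.
Proof.
rewrite -mulr2n -[x *+ 2]mulr_natl mulrA -(rmorph_nat rc) -rmorphM.
by rewrite mulVf ?pnatr_eq0 // rmorph1 mul1r.
Qed.

Lemma tr_average r Q X : r *m r = 1%:M -> Q *m r = r *m Q ->
  \tr (Q *m average r X) = \tr (Q *m X).
Proof.
move=> rr Qr; rewrite /average -scalemxAr mxtraceZ mulmxDr mxtraceD.
have -> : \tr (Q *m (r *m X *m r)) = \tr (Q *m X).
  rewrite mulmxA mxtrace_mulC !mulmxA -Qr -(mulmxA Q) rr mulmx1 //.
exact: rc_half.
Qed.

(** Unless [L] commutes with [A], averaging [L] and its mirror image in some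
    eigenspace of [A] strictly decreases the Frobenius norm; pinching the result
    to the commutant of [S] then gives a matrix [Z] different from [L].  Its
    differences with [L] are invisible to whatever commutes with [A] and [S]. *)
Lemma pinching U s P a L :
  U \is unitarymx -> P \is unitarymx -> L^t* = L ->
  udiag P a *m L != L *m udiag P a ->
  exists Z, [/\ Z^t* = Z, N Z <= N L, Z != L,
    udiag U s *m Z = Z *m udiag U s &
    forall Q, udiag U s *m Q = Q *m udiag U s -> udiag P a *m Q = Q *m udiag P a ->
      \tr (Q *m Z) = \tr (Q *m L)].
Proof.
move=> hU hP hL ne.
have [i nei] : exists i, reflection P a i *m L != L *m reflection P a i.
  apply/existsP; rewrite -[[exists _, _]]negbK negb_exists.
  apply: contraNN ne => /forallP h; apply/eqP/(comm_reflectionP a L hP) => i.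
  by have := h i; rewrite negbK => /eqP.
pose Pr Z := [/\ Z^t* = Z, N Z <= N L, frosq Z < frosq L &
    forall Q, udiag U s *m Q = Q *m udiag U s -> udiag P a *m Q = Q *m udiag P a ->
      \tr (Q *m Z) = \tr (Q *m L)].
have Pr0 : Pr (average (reflection P a i) L).
  split.
  - by apply: average_adj => //; apply: reflection_adj.
  - by apply: un_average; [apply: reflection_unitary | apply: reflection_adj].
  - by apply: frosq_average_lt => //; [apply: reflection_adj | apply: reflection_sq].
  - move=> Q _ QA; apply: tr_average; first exact: reflection_sq.
    by apply/esym; apply: (proj2 (comm_reflectionP a Q hP)).
have Pr1 j Z : Pr Z -> Pr (average (reflection U s j) Z).
  case=> [Za Zn Zf Zt]; split.
  - by apply: average_adj => //; apply: reflection_adj.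
  - apply: le_trans Zn.
    by apply: un_average; [apply: reflection_unitary | apply: reflection_adj].
  - apply: le_lt_trans Zf.
    by apply: frosq_average_le => //; [apply: reflection_adj | apply: reflection_sq].
  - move=> Q QS QA; rewrite -(Zt Q QS QA); apply: tr_average; first exact: reflection_sq.
    by apply/esym; apply: (proj2 (comm_reflectionP s Q hU)).
have [Z [[Za Zn Zf Zt] Zc]] := @average_all R C d _ (reflection U s) Pr (enum 'I_d) _
  (fun j => reflection_sq s j hU) (fun j k => udiagC _ _ hU) Pr1 Pr0.
exists Z; split=> //.
  by apply: contraTneq Zf => ->; rewrite ltxx.
by apply/(comm_reflectionP s Z hU) => j; apply: Zc; rewrite mem_enum.
Qed.

(** In a common eigenbasis of [S] and the matrix [Z] given by [pinching], [w] is
    half of [Z - log S].  Strict convexity gives the decrease at [t = 1], and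
    convexity the linear rate in between. *)
Lemma descent_direction S A : pd S -> A^t* = A -> A *m S != S *m A ->
  exists U s w, [/\ U \is unitarymx, S = udiag U s, forall i, 0 < s 0 i,
    (forall Q, S *m Q = Q *m S -> A *m Q = Q *m A ->
       \tr (Q *m udiag U w) = 0) &
    exists2 e, 0 < e & forall t, 0 <= t -> t <= 1 ->
      N (udiag U (map_mx (@ln R) s + t *: w)) <= N (mxlog S) - t * e].
Proof.
move=> pS /herm_ex [P [a [hP eA]]] ne.
have [U [s [hU s0 eS]]] := pd_udiag pS.
have lnK' : map_mx (@expR R) (map_mx (@ln R) s) = s.
  by apply/rowP=> i; rewrite !mxE lnK ?posrE.
have neL : udiag P a *m mxlog S != mxlog S *m udiag P a.
  apply: contraNneq ne => e; rewrite eS mxlog_udiag // in e.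
  have := comm_fun (@expR R) hU (esym e).
  by rewrite lnK' eS eA => ->.
have hL : (mxlog S)^t* = mxlog S by rewrite eS mxlog_udiag // udiag_adj.
have [Z [hZ nZ ZL ZS Ztr]] := pinching s hU hP hL neL.
rewrite -eS -eA in ZS Ztr.
have hS : S^t* = S by rewrite eS udiag_adj.
have [V [b [z [hV eSV eZ]]]] := simdiag hS hZ ZS.
have b0 i : 0 < b 0 i by apply: (pd_udiag_gt0 (U := V)) => //; rewrite -eSV.
pose x := map_mx (@ln R) b.
have eL : mxlog S = udiag V x by rewrite eSV mxlog_udiag.
have zx : z != x by apply: contraNneq ZL => zx; rewrite eZ eL zx.
have nzx : N (rdiag C z) <= N (rdiag C x).
  by rewrite -(un_udiag hN z hV) -(un_udiag hN x hV) -eZ -eL.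
have h0 : 0 < (2^-1 : R) by rewrite invr_gt0 ltr0n.
have h1 : (2^-1 : R) < 1 by rewrite invf_lt1 ?ltr0n // ltr1n.
have := un_strict hN nzx zx h0 h1; set m := _ + _ => ltm.
exists V, b, (m - x); split=> //.
  move=> Q QS QA; have -> : m - x = 2^-1 *: (z - x).
    by apply/rowP=> i; rewrite !mxE; field.
  rewrite -udiagZ -scalemxAr mxtraceZ.
  have -> : udiag V (z - x) = Z - mxlog S.
    by rewrite eZ eL -[- x]scaleN1r -udiagD -udiagZ rmorphN1 scaleN1r.
  by rewrite mulmxBr raddfB /= Ztr // subrr mulr0.
exists (N (rdiag C x) - N (rdiag C m)); first by rewrite subr_gt0.
move=> t t0 t1; rewrite eL !un_udiag //.
have -> : x + t *: (m - x) = (1 - t) *: x + t *: m.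
  by apply/rowP=> i; rewrite !mxE; ring.
rewrite -rdiag_add -!rdiagZ; apply: le_trans (un_tri hN _ _) _.
rewrite !un_rcZ ?subr_ge0 //; lra.
Qed.
End Descent.

(** * Solvability of linear equations *)

Section Fredholm.
Variable (F : fieldType).

(** A row space is cut out by the linear forms that vanish on it, here the
    columns of the cokernel. *)
Lemma solve2 m (A B : 'M[F]_m) (w : 'rV[F]_m) :
  (forall y : 'cV_m, A *m y = 0 -> B *m y = 0 -> w *m y = 0) ->
  exists u v : 'rV_m, u *m A + v *m B = w.
Proof.
move=> h; suff /submxP [D eD] : (w <= col_mx A B)%MS.
  by exists (lsubmx D), (rsubmx D); rewrite -mul_row_col hsubmxK.
rewrite submxE; apply/eqP/matrixP=> i j; set M := cokermx _.
suff : w *m (M *m delta_mx j 0) = 0 :> 'cV_1.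
  by rewrite mulmxA -colE => /colP/(_ i); rewrite [LHS]mxE => ->; rewrite !mxE.
have : col_mx A B *m (M *m delta_mx j 0) = 0 :> 'cV_(m + m).
  by rewrite mulmxA mulmx_coker mul0mx.
rewrite mul_col_mx => /eqP; rewrite col_mx_eq0 => /andP[/eqP hA /eqP hB].
exact: h.
Qed.

Variable d : nat.
Implicit Types (K X Y Z : 'M[F]_d).

Lemma mxvec_tr Z Y : (mxvec Z *m (mxvec Y^T)^T) 0 0 = \tr (Z *m Y).
Proof.
rewrite mxE (reindex _ (curry_mxvec_bij _ _)) /= /mxtrace.
under [RHS]eq_bigr do rewrite mxE.
rewrite pair_bigA /=; apply: eq_bigr => -[i j] _ /=.
by rewrite mxvecE mxE mxvecE mxE.
Qed.

Lemma tr_eq0 Y : (forall X, \tr (X *m Y) = 0) -> Y = 0.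
Proof.
move=> h; apply/matrixP=> i j; have := h (delta_mx j i).
rewrite /mxtrace (bigD1 j) //= big1 ?addr0 => [|k /negPf kj].
  rewrite mxE (bigD1 i) //= big1 ?addr0 => [|k /negPf ki].
    by rewrite !mxE !eqxx mul1r.
  by rewrite !mxE ki andbF mul0r.
by rewrite mxE big1 // => l _; rewrite !mxE kj mul0r.
Qed.

End Fredholm.

(** * Velocities of conjugations *)

Section Commutators.
Variables (R : realType) (C : complexField R) (d : nat).
Implicit Types (U V H X Y T G L S A Q Z K W : 'M[C]_d).

Definition bracket X Y : 'M[C]_d := X *m Y - Y *m X.

(** If the linear form [tr (_ Y)] vanishes on all values of the left-hand side,
    then [Y] commutes with [S], and [T Y T] with [G].  Together these make [Y S]
    commute with [S] and with [T T], so the form also vanishes on [S W], by the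
    hypothesis on [W]. *)
Lemma solve_commutators S T G W : S = T *m G *m T ->
  (forall Q, S *m Q = Q *m S -> T *m T *m Q = Q *m (T *m T) ->
     \tr (Q *m W) = 0) ->
  exists K X, T *m (bracket G K) *m T + (bracket S X) = S *m W.
Proof.
move=> eS hW.
pose Mf := lin_mulmx (T *m G) *m lin_mulmxr T - lin_mulmx T *m lin_mulmxr (G *m T).
pose Mg := lin_mulmx S - lin_mulmxr S.
have ef K : mxvec K *m Mf = mxvec (T *m (bracket G K) *m T).
  rewrite mulmxBr !mulmxA !mul_vec_lin /= -linearB /=; congr mxvec.
  by rewrite /bracket mulmxBr mulmxBl !mulmxA.
have eg X : mxvec X *m Mg = mxvec (bracket S X).
  by rewrite mulmxBr !mul_vec_lin /= -linearB.
have [y yf yg|u [v e]] := @solve2 _ _ Mf Mg (mxvec (S *m W)); last first.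
  exists (vec_mx u), (vec_mx v); apply: (can_inj mxvecK).
  by rewrite linearD /= -ef -eg !vec_mxK.
(* [Y] represents the linear form [y] through the trace *)
pose Y := (vec_mx y^T)^T.
have ey : y = (mxvec Y^T)^T by rewrite /Y trmxK vec_mxK trmxK.
have hf K : \tr (T *m (bracket G K) *m T *m Y) = 0.
  by rewrite -mxvec_tr -ey -ef -mulmxA yf mulmx0 mxE.
have hg X : \tr ((bracket S X) *m Y) = 0.
  by rewrite -mxvec_tr -ey -eg -mulmxA yg mulmx0 mxE.
have YS : Y *m S = S *m Y.
  apply/eqP; rewrite -subr_eq0; apply/eqP/tr_eq0 => X; rewrite -[RHS](hg X).
  rewrite /bracket mulmxBr mulmxBl !raddfB /=; congr (_ - _).
    by rewrite !mulmxA mxtrace_mulC !mulmxA.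
  by rewrite !mulmxA.
have YG : T *m Y *m T *m G = G *m T *m Y *m T.
  apply/eqP; rewrite -subr_eq0; apply/eqP/tr_eq0 => K; rewrite -[RHS](hf K).
  rewrite /bracket !(mulmxBr, mulmxBl) !raddfB /=; congr (_ - _).
    by rewrite -!mulmxA [RHS]mxtrace_mulC -!mulmxA [RHS]mxtrace_mulC !mulmxA.
  by rewrite -!mulmxA [RHS]mxtrace_mulC !mulmxA.
have SY2 : T *m T *m (Y *m S) = Y *m S *m (T *m T).
  have := congr1 (fun M => T *m M *m T) YG.
  rewrite /= !mulmxA => e.
  by rewrite {1}eS !mulmxA e YS eS.
apply/matrixP=> i j; rewrite !ord1 ey mxvec_tr [RHS]mxE.
rewrite mxtrace_mulC mulmxA; apply: hW SY2.
by rewrite mulmxA -YS.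
Qed.
Lemma bracket_adj X Y : (bracket X Y)^t* = - bracket (X^t*) (Y^t*).
Proof. by rewrite /bracket adjmxB !adjmxM opprB. Qed.

Definition skew_part X : 'M[C]_d := rc 2^-1 *: (X - X^t*).

Lemma skew_part_adj X : (skew_part X)^t* = - skew_part X.
Proof. by rewrite /skew_part adjmxZ adjmxB trmxCK -scalerN opprB. Qed.

Lemma bracket_skew X Y : X^t* = X ->
  bracket X (skew_part Y) = rc 2^-1 *: (bracket X Y + (bracket X Y)^t*).
Proof.
move=> hX; rewrite bracket_adj hX /bracket /skew_part -scalemxAr -scalemxAl.
rewrite -scalerBr mulmxBr mulmxBl !opprB; congr (_ *: _).
by rewrite addrACA [RHS]addrACA; congr (_ + _); rewrite addrC.
Qed.

(** As both sides are selfadjoint, the unknowns may be taken skew-adjoint, that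
    is, tangent to the unitary group. *)
Lemma solve_skew S T G W : S = T *m G *m T ->
  S^t* = S -> T^t* = T -> G^t* = G -> (S *m W)^t* = S *m W ->
  (forall Q, S *m Q = Q *m S -> T *m T *m Q = Q *m (T *m T) ->
     \tr (Q *m W) = 0) ->
  exists K X, [/\ K^t* = - K, X^t* = - X &
    T *m bracket G K *m T + bracket S X = S *m W].
Proof.
move=> eS hS hT hG hSW /(solve_commutators eS) [K [X e]].
exists (skew_part K), (skew_part X); split; try exact: skew_part_adj.
rewrite !bracket_skew // -scalemxAr -scalemxAl -scalerDr.
rewrite mulmxDr mulmxDl addrACA e.
have -> : T *m (bracket G K)^t* *m T + (bracket S X)^t* = S *m W.
  move: (bracket G K) (bracket S X) e => M M' e.
  by rewrite -hSW -e adjmxD !adjmxM hT mulmxA.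
rewrite -mulr2n -[S *m W *+ 2]scaler_nat scalerA -(rmorph_nat rc) -rmorphM.
by rewrite mulVf ?pnatr_eq0 // rmorph1 scale1r.
Qed.

End Commutators.

(** * Expansions of matrix curves *)

Section Jets.
Variables (R : realType) (C : complexField R) (d : nat).
Implicit Types (U V H X Y T G L S A Q Z K W : 'M[C]_d) (F : R -> 'M[C]_d).

(** The first-order expansion of [F] at [0].  The error bound holds on
    the whole interval from [0] to [1], so that products need no smaller one. *)
Definition jet F X Y := exists2 c, 0 <= c & forall t, 0 <= t -> t <= 1 ->
  l1norm (F t - (X + rc t *: Y)) <= c * t ^+ 2.

Lemma jet_const X : jet (fun=> X) X 0.
Proof.
exists 0 => // t _ _; rewrite scaler0 addr0 subrr mul0r.
by rewrite -(scale0r 0) l1normZ cabs0 mul0r.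
Qed.

Lemma jet_adj F X Y : jet F X Y -> jet (fun t => (F t)^t*) (X^t*) (Y^t*).
Proof.
case=> c c0 h; exists c => // t t0 t1.
by rewrite -adjmxZ -adjmxD -adjmxB l1norm_adj h.
Qed.

Lemma l1norm_rcZ t X : 0 <= t -> l1norm (rc t *: X) = t * l1norm X.
Proof. by move=> t0; rewrite l1normZ cabs_rc ger0_norm. Qed.

Lemma l1norm_le_dist X Y : l1norm X <= l1norm Y + l1norm (X - Y).
Proof. by rewrite -{1}(subrK Y X) addrC l1normD. Qed.

Lemma jet_mul F1 F2 X1 Y1 X2 Y2 : jet F1 X1 Y1 -> jet F2 X2 Y2 ->
  jet (fun t => F1 t *m F2 t) (X1 *m X2) (X1 *m Y2 + Y1 *m X2).
Proof.
case=> c1 c10 h1 [c2 c20 h2].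
exists (c1 * (l1norm X2 + l1norm Y2 + c2) + (l1norm X1 + l1norm Y1) * c2 +
  l1norm Y1 * l1norm Y2).
  by rewrite !addr_ge0 // mulr_ge0 // ?addr_ge0 // l1norm_ge0.
move=> t t0 t1; set D1 := X1 + rc t *: Y1; set D2 := X2 + rc t *: Y2.
have t2 : t ^+ 2 <= 1 by rewrite expr_le1.
have -> : F1 t *m F2 t - (X1 *m X2 + rc t *: (X1 *m Y2 + Y1 *m X2)) =
    (F1 t - D1) *m F2 t + D1 *m (F2 t - D2) + rc (t ^+ 2) *: (Y1 *m Y2).
  have -> : rc (t ^+ 2) *: (Y1 *m Y2) =
      D1 *m D2 - (X1 *m X2 + rc t *: (X1 *m Y2 + Y1 *m X2)).
    rewrite /D1 /D2 mulmxDl !mulmxDr -!scalemxAr -!scalemxAl.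
    by apply/matrixP=> i j; rewrite !mxE; ring.
  rewrite mulmxBl mulmxBr; apply/matrixP=> i j; rewrite !mxE; ring.
have b2 : l1norm (F2 t) <= l1norm X2 + l1norm Y2 + c2.
  apply: le_trans (l1norm_le_dist _ D2) _; apply: lerD.
    apply: le_trans (l1normD _ _) _; rewrite lerD2l l1norm_rcZ //.
    by rewrite ler_piMl ?l1norm_ge0.
  by apply: le_trans (h2 t t0 t1) _; rewrite ler_piMr.
have b1 : l1norm D1 <= l1norm X1 + l1norm Y1.
  apply: le_trans (l1normD _ _) _; rewrite lerD2l l1norm_rcZ //.
  by rewrite ler_piMl ?l1norm_ge0.
apply: le_trans (l1normD _ _) _; rewrite 2!mulrDl; apply: lerD; last first.
  by rewrite l1norm_rcZ ?exprn_ge0 // mulrC ler_wpM2r ?exprn_ge0 // l1normM.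
apply: le_trans (l1normD _ _) _; apply: lerD; apply: le_trans (l1normM _ _) _.
  rewrite [leRHS]mulrAC; apply: ler_pM; rewrite ?l1norm_ge0 //; exact: h1.
by rewrite -[leRHS]mulrA; apply: ler_pM; rewrite ?l1norm_ge0 //; exact: h2.
Qed.

(** The Cayley transform replaces the exponential as a curve of unitary matrices
    with velocity [K]; being rational, it is expanded by algebra alone. *)
Definition cayley K (t : R) : 'M[C]_d :=
  (1%:M + rc (t / 2) *: K) *m invmx (1%:M - rc (t / 2) *: K).

Lemma row_sq_eq0 (v : 'rV[C]_d) : v *m v^t* = 0 -> v = 0.
Proof.
move/matrixP/(_ 0 0); rewrite mulE mxE.
under eq_bigr do rewrite adjE -normCK.
move/eqP; rewrite psumr_eq0 => [/allP h|i _]; last by rewrite exprn_ge0.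
apply/rowP=> i; have /implyP/(_ isT) := h i (mem_index_enum _).
by rewrite expf_eq0 normr_eq0 mxE => /eqP.
Qed.

(** On a kernel vector [v], the number [v v^*] would be both selfadjoint and
    skew-adjoint, hence [0]. *)
Lemma one_sub_skew_unit K t : K^t* = - K -> 1%:M - rc t *: K \in unitmx.
Proof.
move=> hK; rewrite -row_free_unit -kermx_eq0; apply/rowV0P => v /sub_kermxP.
rewrite mulmxBr mulmx1 => /eqP; rewrite subr_eq0 => /eqP ev.
apply: row_sq_eq0; set n := v *m v^t*.
have hn : n^t* = n by rewrite /n adjmxM trmxCK.
have e1 : n = rc t *: (v *m K *m v^t*).
  by rewrite /n {1}ev -scalemxAr -scalemxAl.
have nN : n^t* = - n.
  rewrite e1 adjmxZ !adjmxM trmxCK hK.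
  by rewrite mulNmx mulmxN scalerN mulmxA.
have /eqP : n + n = 0 by rewrite -{1}hn nN addNr.
by rewrite -mulr2n -scaler_nat scaler_eq0 pnatr_eq0 /= => /eqP.
Qed.

Lemma cayley_eq K t : K^t* = - K ->
  cayley K t - 1%:M = rc (t / 2) *: ((1%:M + cayley K t) *m K).
Proof.
move=> hK; have hM := one_sub_skew_unit (t / 2) hK.
have : cayley K t *m (1%:M - rc (t / 2) *: K) = 1%:M + rc (t / 2) *: K.
  by rewrite /cayley mulmxKV.
rewrite mulmxBr mulmx1 -scalemxAr => /eqP; rewrite subr_eq => /eqP e.
by rewrite mulmxDl mul1mx scalerDr {1}e addrAC [1%:M + _]addrC addrK.
Qed.

Lemma cayley_unitary K t : K^t* = - K -> cayley K t \is unitarymx.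
Proof.
move=> hK; set M := 1%:M - rc (t / 2) *: K; set P := 1%:M + rc (t / 2) *: K.
have hM : M \in unitmx := one_sub_skew_unit (t / 2) hK.
have aM : M^t* = P by rewrite /M adjmxB adjmx1 adjmxZ hK scalerN opprK.
have aP : P^t* = M by rewrite -aM trmxCK.
have hP : P \in unitmx.
  have := one_sub_skew_unit (K := - K) (t / 2).
  by rewrite adjmxN hK scalerN !opprK; apply.
have PM : P *m M = M *m P.
  rewrite /P /M; move: (_ *: K) => Q.
  rewrite !(mulmxDl, mulmxDr, mulNmx, mulmxN, mul1mx, mulmx1).
  by apply/matrixP=> i j; rewrite !mxE; ring.
have aI : (invmx M)^t* = invmx P by rewrite trmx_inv map_invmx aM.
have PMI : P *m invmx M = invmx M *m P.
  by rewrite -[P in LHS](mulKmx hM) -PM -!mulmxA mulmxV // mulmx1.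
apply/unitarymxP; rewrite /cayley -/M -/P adjmxM aP aI PMI.
by rewrite !mulmxA mulmxK // mulVmx.
Qed.

(** Using [cayley_eq] twice leaves [(t / 2)^2 (1 + U) K^2] as the error. *)
Lemma jet_cayley K : K^t* = - K -> jet (cayley K) 1%:M K.
Proof.
move=> hK; exists (sqdim R d *+ 2 * l1norm K ^+ 2).
  by rewrite mulr_ge0 ?exprn_ge0 ?l1norm_ge0 // mulrn_wge0 ?sqdim_ge0.
move=> t t0 t1; have e := cayley_eq t hK; set U := cayley K t in e *.
have hU : U \is unitarymx := cayley_unitary t hK.
have -> : U - (1%:M + rc t *: K) =
    rc ((t / 2) ^+ 2) *: ((1%:M + U) *m (K *m K)).
  have -> : rc ((t / 2) ^+ 2) *: ((1%:M + U) *m (K *m K)) =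
      rc (t / 2) *: ((U - 1%:M) *m K).
    by rewrite e -scalemxAl scalerA -rmorphM -expr2 mulmxA.
  rewrite [in RHS]mulmxBl opprD addrA e mulmxDl mul1mx.
  have -> : rc t = rc (t / 2) + rc (t / 2) :> C.
    by rewrite -rmorphD; congr (rc _); field.
  by apply/matrixP=> i j; rewrite !mxE; ring.
rewrite l1norm_rcZ ?sqr_ge0 // mulrC.
apply: ler_pM; rewrite ?l1norm_ge0 ?sqr_ge0 //.
  apply: le_trans (l1normM _ _) _; apply: ler_pM; rewrite ?l1norm_ge0 //.
    apply: le_trans (l1normD _ _) _; rewrite mulr2n lerD ?l1norm_unitary //.
    exact: unitary1.
  by rewrite expr2 l1normM.
by rewrite ler_sqr ?nnegrE //; lra.
Qed.
End Jets.

(** * Local minimizers commute *)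

Section FirstOrder.
Variables (R : realType) (C : complexField R) (d : nat).
Implicit Types (U V H X Y T G L S A Q Z K W P : 'M[C]_d) (a b s w : 'rV[R]_d).

Lemma pd_of_udiag U a : U \is unitarymx -> (forall i, 0 < a 0 i) -> pd (udiag U a).
Proof.
move=> hU a0; split; first exact: udiag_adj.
move=> v v0; have -> : v^t* *m udiag U a *m v =
    (U *m v)^t* *m (rdiag C a *m (U *m v)) by rewrite /udiag adjmxM !mulmxA.
have {v0} : U *m v != 0.
  apply: contraNneq v0 => e.
  by rewrite -(unitKl v hU) -mulmxA e mulmx0.
move: (U *m v) => u u0; rewrite mulE.
have pos k : 0 <= (u^t*) 0 k * (rdiag C a *m u) k 0.
  rewrite mul_rdiagE adjE mulrCA -normCKC mulr_ge0 ?exprn_ge0 //.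
  by rewrite ler0_rc ltW.
have [k uk] : exists k, u k 0 != 0.
  apply/existsP; apply: contraNT u0; rewrite negb_exists => /forallP h.
  by apply/eqP/colP=> k; have := h k; rewrite negbK mxE => /eqP.
rewrite (bigD1 k) //= ltr_pwDl ?sumr_ge0 //.
rewrite mul_rdiagE adjE mulrCA -normCKC mulr_gt0 ?ltr0_rc //.
by rewrite exprn_gt0 // normr_gt0.
Qed.

Lemma l1norm_udiag U a : U \is unitarymx ->
  l1norm (udiag U a) <= sqdim R d ^+ 2 * \sum_i `|a 0 i|.
Proof.
move=> hU; apply: le_trans (l1norm_sandwich _ (adj_unitary hU) hU) _.
rewrite ler_wpM2l ?exprn_ge0 ?sqdim_ge0 //; apply: ler_sum => i _.
rewrite (bigD1 i) //= big1 => [|j /negPf ji].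
  by rewrite rdiagE eqxx mulr1n cabs_rc addr0.
by rewrite rdiagE eq_sym ji mulr0n cabs0.
Qed.

Lemma le_sum_norm w i : `|w 0 i| <= \sum_j `|w 0 j|.
Proof. by rewrite (bigD1 i) //= lerDl sumr_ge0. Qed.

(** All the matrices are diagonal in the basis [P], so this is the expansion
    [ln (1 + u) = u + O(u^2)] of each eigenvalue.  The bounded inverse [F'] is
    what [mxlog_lip] asks for. *)
Lemma mxlog_second_order P s w : P \is unitarymx -> (forall i, 0 < s 0 i) ->
  exists2 k, 0 <= k & exists2 e, 0 < e & forall t, 0 <= t -> t <= e ->
    let F := udiag P s + rc t *: (udiag P s *m udiag P w) in
    [/\ pd F, exists2 F', F *m F' = 1%:M & l1norm F' <= k &
      l1norm (mxlog F - udiag P (map_mx (@ln R) s + t *: w)) <= k * t ^+ 2].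
Proof.
move=> hP s0; pose om := \sum_j `|w 0 j|.
have om0 : 0 <= om by apply: sumr_ge0.
pose k1 := sqdim R d ^+ 2 * \sum_i (`|(s 0 i)^-1| * 2).
pose k2 := sqdim R d ^+ 2 * \sum_i (2 * `|w 0 i| ^+ 2).
have k10 : 0 <= k1.
  apply: mulr_ge0; first by rewrite exprn_ge0 ?sqdim_ge0.
  by apply: sumr_ge0 => i _; apply: mulr_ge0.
have k20 : 0 <= k2.
  apply: mulr_ge0; first by rewrite exprn_ge0 ?sqdim_ge0.
  by apply: sumr_ge0 => i _; apply: mulr_ge0 => //; apply: exprn_ge0.
exists (k1 + k2); first by rewrite addr_ge0.
(* for these [t] every [t * w 0 i] is at most [1 / 2] in absolute value *)
exists (2 * (om + 1))^-1; first by rewrite invr_gt0 mulr_gt0 // ltr_wpDl.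
move=> t t0 te F; pose f := \row_i (s 0 i * (1 + t * w 0 i)).
have tw i : `|t * w 0 i| <= 2^-1.
  rewrite normrM ger0_norm //.
  apply: (@le_trans _ _ ((2 * (om + 1))^-1 * (om + 1))).
    rewrite ler_pM //; apply: le_trans (le_sum_norm w i) _.
    by rewrite lerDl.
  by rewrite invfM -mulrA mulVf ?mulr1 // gt_eqF // ltr_wpDl.
have tw1 i : 2^-1 <= 1 + t * w 0 i.
  have := tw i; rewrite ler_norml => /andP[h _]; lra.
have eF : F = udiag P f.
  rewrite /F udiagM // udiagZ udiagD; congr udiag.
  by apply/rowP=> i; rewrite !mxE; ring.
have f0 i : 0 < f 0 i.
  by rewrite mxE mulr_gt0 //; apply: lt_le_trans (tw1 i); rewrite invr_gt0.
split; first by rewrite eF; apply: pd_of_udiag.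
  exists (udiag P (map_mx (fun x => x^-1) f)); first by rewrite eF udiag_inv.
  apply: le_trans (l1norm_udiag _ hP) _; apply: (@le_trans _ _ k1); last by rewrite lerDl.
  rewrite /k1 ler_wpM2l ?exprn_ge0 ?sqdim_ge0 //.
  apply: ler_sum => i _; rewrite mapE mxE invfM normrM ler_wpM2l //.
  rewrite normfV ger0_norm; last by apply: le_trans (tw1 i); rewrite invr_ge0.
  by rewrite -[leRHS]invrK lef_pV2 ?tw1 // posrE ?invr_gt0 //;
     apply: lt_le_trans (tw1 i); rewrite invr_gt0.
rewrite eF mxlog_udiag //.
have -> : udiag P (map_mx (@ln R) f) - udiag P (map_mx (@ln R) s + t *: w) =
    udiag P (\row_i (ln (1 + t * w 0 i) - t * w 0 i)).
  rewrite -[X in _ - X]scale1r -(rmorph1 rc) -scaleNr -rmorphN udiagZ udiagD.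
  congr udiag; apply/rowP=> i; rewrite !mxE lnM ?posrE //; first by ring.
  by apply: lt_le_trans (tw1 i); rewrite invr_gt0.
apply: le_trans (l1norm_udiag _ hP) _.
apply: (@le_trans _ _ (k2 * t ^+ 2)); last first.
  by rewrite ler_wpM2r ?sqr_ge0 // lerDr.
rewrite /k2 -mulrA ler_wpM2l ?exprn_ge0 ?sqdim_ge0 // mulr_suml.
apply: ler_sum => i _; rewrite mxE.
apply: le_trans (ln1_bound (tw i)) _.
by rewrite exprMn [t ^+ 2 * _]mulrC mulrA real_normK ?num_real.
Qed.

Lemma conj_inv V X X' : V \is unitarymx -> X *m X' = 1%:M ->
  (V^t* *m X *m V) *m (V^t* *m X' *m V) = 1%:M.
Proof.
move=> hV e; rewrite !mulmxA (mulmxtVK _ hV) -(mulmxA (V^t*)) e mulmx1.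
exact: unitaryr.
Qed.

Lemma sandwich_inv T X X' : T \in unitmx -> X *m X' = 1%:M ->
  (T *m X *m T) *m (invmx T *m X' *m invmx T) = 1%:M.
Proof.
by move=> uT e; rewrite !mulmxA mulmxK // -(mulmxA T) e mulmx1 mulmxV.
Qed.

Lemma pd_inv G : pd G -> exists G', G *m G' = 1%:M.
Proof.
by move=> /pd_udiag [U [a [hU a0 ->]]]; exists (udiag U (map_mx (fun x => x^-1) a));
   apply: udiag_inv.
Qed.

(** The added [1] makes the bound meaningful for [y = 0], and the halving makes
    the conclusion strict. *)
Lemma small_mul (t x y : R) : 0 < t -> 0 < x -> 0 <= y ->
  t <= x / (y + 1) / 2 -> t * y < x.
Proof.
move=> t0 x0 y0; rewrite ler_pdivlMr // ler_pdivlMr ?ltr_wpDl // => h.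
nra.
Qed.

Lemma jet_ext (F F' : R -> 'M[C]_d) X Y X' Y' :
  F =1 F' -> X = X' -> Y = Y' -> jet F X Y -> jet F' X' Y'.
Proof.
by move=> eF <- <- [c c0 h]; exists c => // t t0 t1; rewrite -eF h.
Qed.

Variables (N : 'M[C]_d -> R) (hN : uinorm N).

(** The role of [T] will be played by [A^(-1/2)]. *)
Definition local_min T G := exists2 e, 0 < e & forall U, U \is unitarymx ->
  l1norm (U^t* *m G *m U - G) < e ->
  N (mxlog (T *m G *m T)) <= N (mxlog (T *m (U^t* *m G *m U) *m T)).

(** Otherwise, moving [G] along a unitary curve of velocity [K] and conjugating
    by one of velocity [X] turns [S] into [S + t S W] up to second order, and
    the norm of the logarithm decreases at the linear rate [dl]. *)
Lemma local_min_comm T G :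
  T^t* = T -> T \in unitmx -> pd G ->
  local_min T G ->
  T *m T *m (T *m G *m T) = T *m G *m T *m (T *m T).
Proof.
move=> hT uT pG [e e0 hmin]; set S := T *m G *m T.
have pS : pd S by have := pd_sandwich uT pG; rewrite hT.
have TT : (T *m T)^t* = T *m T by rewrite adjmxM hT.
apply/eqP; apply/negPn/negP => ne.
have [P [s [w [hP eS s0 wQ [dl dl0 hdl]]]]] := descent_direction hN pS TT ne.
pose W := udiag P w.
have hSW : (S *m W)^t* = S *m W by rewrite eS udiagM // udiag_adj.
have [K [X [hK hX eKX]]] := solve_skew (erefl S) pS.1 hT pG.1 hSW wQ.
pose U := cayley K; pose V := cayley X.
have uU t : U t \is unitarymx := cayley_unitary t hK.
have uV t : V t \is unitarymx := cayley_unitary t hX.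
pose Gt t := (U t)^t* *m G *m U t.
have jG : jet Gt G (bracket G K).
  have j1 := jet_adj (jet_cayley hK).
  apply: jet_ext (jet_mul (jet_mul j1 (jet_const G)) (jet_cayley hK)) => //.
    by rewrite adjmx1 mul1mx mulmx1.
  by rewrite adjmx1 hK mulmx0 add0r mul1mx mulmx1 mulNmx.
pose Y t := (V t)^t* *m (T *m Gt t *m T) *m V t.
have jY : jet Y S (S *m W).
  have j1 := jet_adj (jet_cayley hX).
  have j2 := jet_mul (jet_mul (jet_const T) jG) (jet_const T).
  apply: jet_ext (jet_mul (jet_mul j1 j2) (jet_cayley hX)) => //.
    by rewrite adjmx1 mul1mx mulmx1.
  rewrite -eKX adjmx1 hX mulmx1 !mul1mx mulmx0 !mul0mx add0r addr0 mulNmx.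
  by rewrite -/S /bracket; apply/matrixP=> i j; rewrite !mxE; ring.
case: jY => cY cY0 hY; case: jG => cG cG0 hG.
have [k k0 [e1 e10 hF]] := mxlog_second_order w hP s0.
have [c1 c10 hc1] := un_lip hN.
have [G' GG'] := pd_inv pG.
pose kY := sqdim R d ^+ 2 *
  (l1norm (invmx T) * (sqdim R d ^+ 2 * l1norm G') * l1norm (invmx T)).
have kY0 : 0 <= kY by rewrite !mulr_ge0 ?exprn_ge0 ?sqdim_ge0 ?l1norm_ge0.
pose M := sqdim R d ^+ 4 * (sqdim R d ^+ 2 * (k + kY) *+ 2).
have M0 : 0 <= M.
  by rewrite mulr_ge0 ?mulrn_wge0 ?mulr_ge0 ?exprn_ge0 ?sqdim_ge0 ?addr_ge0.
pose b := l1norm (bracket G K) + cG.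
have b0 : 0 <= b by rewrite addr_ge0 ?l1norm_ge0.
pose B := c1 * (M * cY + k).
have B0 : 0 <= B by rewrite mulr_ge0 // addr_ge0 // mulr_ge0.
(* small enough for the expansions, for closeness to [G], and for the linear
   gain to beat the quadratic error *)
pose t := Num.min (Num.min 1 e1)
  (Num.min (e / (b + 1) / 2) (dl / (B + 1) / 2)).
have t0 : 0 < t by rewrite !lt_min ltr01 e10 !divr_gt0 // ltr_wpDl.
have t1 : t <= 1 by rewrite !ge_min lexx.
have te1 : t <= e1 by rewrite !ge_min lexx !orbT.
have tb : t * b < e by apply: small_mul => //; rewrite !ge_min lexx !orbT.
have tB : t * B < dl by apply: small_mul => //; rewrite !ge_min lexx !orbT.
have t2 : t ^+ 2 <= t by rewrite expr2 ler_piMl // ltW.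
have close : l1norm (Gt t - G) < e.
  apply: le_lt_trans tb; have := hG t (ltW t0) t1 => h.
  have -> : Gt t - G =
      rc t *: bracket G K + (Gt t - (G + rc t *: bracket G K)).
    by apply/matrixP=> i j; rewrite !mxE; ring.
  apply: le_trans (l1normD _ _) _; rewrite /b mulrDr (l1norm_rcZ _ (ltW t0)) lerD2l.
  apply: le_trans h _; rewrite mulrC ler_wpM2r //.
have pGt : pd (Gt t) by apply: pd_sandwich pG; apply: unitarymx_unit.
have pTGT : pd (T *m Gt t *m T) by have := pd_sandwich uT pGt; rewrite hT.
have pY : pd (Y t) by apply: pd_sandwich pTGT; apply: unitarymx_unit.
have iY : exists2 Y', Y t *m Y' = 1%:M & l1norm Y' <= kY.
  pose Z := (U t)^t* *m G' *m U t.
  have eZ : (T *m Gt t *m T) *m (invmx T *m Z *m invmx T) = 1%:M.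
    exact: sandwich_inv uT (conj_inv (uU t) GG').
  exists ((V t)^t* *m (invmx T *m Z *m invmx T) *m V t); first exact: conj_inv.
  apply: le_trans (l1norm_sandwich _ (adj_unitary (uV t)) (uV t)) _.
  rewrite ler_wpM2l ?exprn_ge0 ?sqdim_ge0 //.
  apply: le_trans (l1norm_mul3 _ _ _) _; rewrite ler_wpM2r ?l1norm_ge0 //.
  rewrite ler_wpM2l ?l1norm_ge0 //.
  exact: l1norm_sandwich (adj_unitary (uU t)) (uU t).
have [pF [F' FF' nF'] lF] := hF t (ltW t0) te1.
have [Y' YY' nY'] := iY.
have nF'k : l1norm F' <= k + kY by apply: le_trans nF' _; rewrite lerDl.
have nY'k : l1norm Y' <= k + kY by apply: le_trans nY' _; rewrite lerDr.
have lip := mxlog_lip pY pF YY' FF' nY'k nF'k.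
move: pF FF' lF lip; set F := _ + _ => pF FF' lF lip.
have YF : l1norm (Y t - F) <= cY * t ^+ 2.
  by have := hY t (ltW t0) t1; rewrite /F -eS.
have h1 : N (mxlog S) <= N (mxlog (Y t)).
  rewrite /Y /mxlog fcalc_conj ?(un_conj hN) //; first exact: hmin (uU t) close.
  exact: pTGT.1.
have h2 := hc1 (mxlog (Y t)) (mxlog F).
have h3 := hc1 (mxlog F) (udiag P (map_mx (@ln R) s + t *: w)).
have h4 := hdl t (ltW t0) t1.
have h5 : c1 * l1norm (mxlog (Y t) - mxlog F) <= c1 * (M * (cY * t ^+ 2)).
  rewrite ler_wpM2l //; apply: le_trans lip _; rewrite -/M ler_wpM2l //.
have h6 : c1 * l1norm (mxlog F - udiag P (map_mx (@ln R) s + t *: w)) <=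
    c1 * (k * t ^+ 2) by rewrite ler_wpM2l.
have h7 : c1 * (M * (cY * t ^+ 2)) + c1 * (k * t ^+ 2) < t * dl.
  have -> : c1 * (M * (cY * t ^+ 2)) + c1 * (k * t ^+ 2) = t * (t * B).
    by rewrite /B; ring.
  by rewrite ltr_pM2l.
have absurd (x y z u p q p' q' r : R) : x <= y -> y <= z + p -> z <= u + q ->
    u <= x - r -> p <= p' -> q <= q' -> p' + q' < r -> False.
  clear; lra.
exact: absurd h1 h2 h3 h4 h5 h6 h7.
Qed.
End FirstOrder.

(** * Rotations in a coordinate plane *)

Section PlaneRotations.
Variables (R : realType) (C : complexField R) (d : nat).
Implicit Types (U V H X Y T G L S A Q Z K W P : 'M[C]_d) (x y : 'rV[R]_d).

(** The spectral theorem for the matrix with rows [(al, be)] and [(be, ga)]: its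
    eigenvalues are at distance [D] from the half trace, and [p] is the cosine
    given by the half-angle formula. *)
Lemma diag2 (al be ga : R) : exists p q m1 m2 : R,
  [/\ p ^+ 2 + q ^+ 2 = 1, al = p ^+ 2 * m1 + q ^+ 2 * m2,
      be = p * q * (m2 - m1) & ga = q ^+ 2 * m1 + p ^+ 2 * m2].
Proof.
have [->|be0] := eqVneq be 0.
  by exists 1, 0, al, ga; split; ring.
pose h := (al - ga) / 2; pose D := Num.sqrt (h ^+ 2 + be ^+ 2).
have b2 : 0 < be ^+ 2 by rewrite exprn_even_gt0.
have D2 : D ^+ 2 = h ^+ 2 + be ^+ 2.
  by rewrite sqr_sqrtr // addr_ge0 ?sqr_ge0.
have D0 : 0 < D by rewrite sqrtr_gt0 ltr_wpDl ?sqr_ge0.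
have hD : 0 < h + D by nra.
pose p := Num.sqrt ((h + D) / (2 * D)).
have p2 : p ^+ 2 = (h + D) / (2 * D).
  by rewrite sqr_sqrtr // divr_ge0 ?mulr_ge0 // ltW.
have p0 : 0 < p by rewrite sqrtr_gt0 divr_gt0 // mulr_gt0.
have q2 : (- be / (2 * D * p)) ^+ 2 = (D - h) / (2 * D).
  rewrite expr_div_n sqrrN !exprMn p2.
  have -> : be ^+ 2 = (D - h) * (D + h) by rewrite -subr_sqr D2; ring.
  by field; rewrite !gt_eqF // addrC.
exists p, (- be / (2 * D * p)), ((al + ga) / 2 + D), ((al + ga) / 2 - D).
have eal : al = (al + ga) / 2 + h by rewrite /h; field.
have ega : ga = (al + ga) / 2 - h by rewrite /h; field.
rewrite q2 p2; split.
- by field; rewrite gt_eqF.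
- by rewrite [LHS]eal; field; rewrite gt_eqF.
- by field; rewrite !gt_eqF.
- by rewrite [LHS]ega; field; rewrite gt_eqF.
Qed.

Variables (i j : 'I_d) (ij : i != j).

(** The block [p q; r s] replaces whatever [x] has at [i] and [j]. *)
Definition block2 x (p q r s : R) : 'M[C]_d := \matrix_(k, l)
  rc (if k == i then (if l == i then p else if l == j then q else 0)
      else if k == j then (if l == i then r else if l == j then s else 0)
      else x 0 k *+ (k == l)).

Lemma block2_mulE x p q r s Y k l : (block2 x p q r s *m Y) k l =
  if k == i then rc p * Y i l + rc q * Y j l
  else if k == j then rc r * Y i l + rc s * Y j l else rc (x 0 k) * Y k l.
Proof.
have ji : (j == i) = false by rewrite eq_sym (negPf ij).
rewrite mulE; case: ifP => [/eqP->|ki].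
  rewrite (bigD1 i) //= (bigD1 j) /= ?ji // big1 => [|m /andP[/negPf mi /negPf mj]].
    by rewrite !mxE !eqxx ji addr0.
  by rewrite !mxE eqxx mi mj rmorph0 mul0r.
case: ifP => [/eqP->|kj].
  rewrite (bigD1 i) //= (bigD1 j) /= ?ji // big1 => [|m /andP[/negPf mi /negPf mj]].
    by rewrite !mxE !eqxx ji addr0.
  by rewrite !mxE eqxx ji mi mj rmorph0 mul0r.
rewrite (bigD1 k) //= big1 ?addr0 => [|m /negPf mk].
  by rewrite !mxE ki kj eqxx mulr1n.
by rewrite !mxE ki kj eq_sym mk rmorph0 mul0r.
Qed.

Lemma block2_mul x y p q r s p' q' r' s' :
  block2 x p q r s *m block2 y p' q' r' s' =
  block2 (\row_k (x 0 k * y 0 k)) (p * p' + q * r') (p * q' + q * s')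
    (r * p' + s * r') (r * q' + s * s').
Proof.
have ji : (j == i) = false by rewrite eq_sym (negPf ij).
apply/matrixP=> k l; rewrite block2_mulE !mxE !eqxx ji.
rewrite -!rmorphM -!rmorphD.
case: ifP => ki; first by case: ifP => li //; case: ifP => lj //; rewrite !mulr0 addr0.
case: ifP => kj; first by case: ifP => li //; case: ifP => lj //; rewrite !mulr0 addr0.
by rewrite ki kj mulrnAr.
Qed.

Lemma block2_adj x p q r s : (block2 x p q r s)^t* = block2 x p r q s.
Proof.
have ji : (j == i) = false by rewrite eq_sym (negPf ij).
apply/matrixP=> k l; rewrite adjE !mxE conj_rc; congr (rc _).
have [eli|/negPf li] := eqVneq l i; have [eki|/negPf ki] := eqVneq k i => //.
- by have [//|/negPf kj] := eqVneq k j; rewrite eli ki.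
- by have [//|/negPf lj] := eqVneq l j; rewrite eki li.
have [elj|/negPf lj] := eqVneq l j; have [ekj|/negPf kj] := eqVneq k j => //.
- by rewrite elj kj.
- by rewrite ekj lj.
by rewrite [k == l]eq_sym; have [->|//] := eqVneq l k.
Qed.

Lemma block2_ext x y p q r s : (forall k, k != i -> k != j -> x 0 k = y 0 k) ->
  block2 x p q r s = block2 y p q r s.
Proof.
move=> e; apply/matrixP=> k l; rewrite !mxE.
by case: eqVneq => // ki; case: eqVneq => // kj; rewrite e.
Qed.

Lemma block2_diag x : rdiag C x = block2 x (x 0 i) 0 0 (x 0 j).
Proof.
have ji : (j == i) = false by rewrite eq_sym (negPf ij).
apply/matrixP=> k l; rewrite rdiagE mxE -rmorphMn; congr (rc _).
have [eki|/negPf ki] := eqVneq k i.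
  have [eli|/negPf li] := eqVneq l i; first by rewrite eki eli eqxx.
  by rewrite eki [i == l]eq_sym li; case: ifP.
have [ekj|/negPf kj] := eqVneq k j; last by [].
have [eli|/negPf li] := eqVneq l i; first by rewrite eli ki.
have [elj|/negPf lj] := eqVneq l j; first by rewrite ekj elj eqxx.
by rewrite ekj [j == l]eq_sym lj.
Qed.

Definition planerot (p q : R) : 'M[C]_d := block2 (const_mx 1) p (- q) q p.

Lemma planerot_adj p q : (planerot p q)^t* = block2 (const_mx 1) p q (- q) p.
Proof. exact: block2_adj. Qed.

Lemma planerot_unitary p q : p ^+ 2 + q ^+ 2 = 1 -> planerot p q \is unitarymx.
Proof.
move=> pq; apply/unitarymxP; rewrite planerot_adj block2_mul.
have -> : 1%:M = rdiag C (const_mx 1) :> 'M[C]_d.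
  by rewrite rdiag_const rmorph1 scale1r.
rewrite block2_diag !mxE; congr block2; try ring: pq; last by rewrite -pq; ring.
- by apply/rowP=> k; rewrite !mxE mulr1.
- by rewrite -pq; ring.
Qed.

Lemma planerot_diag p q x : (planerot p q)^t* *m rdiag C x *m planerot p q =
  block2 x (p ^+ 2 * x 0 i + q ^+ 2 * x 0 j) (p * q * (x 0 j - x 0 i))
    (p * q * (x 0 j - x 0 i)) (q ^+ 2 * x 0 i + p ^+ 2 * x 0 j).
Proof.
rewrite planerot_adj block2_diag !block2_mul; congr block2; try ring.
by apply/rowP=> k; rewrite !mxE mul1r mulr1.
Qed.
End PlaneRotations.

(** * Local minimizers order the eigenvalues alike *)

Section Ordering.
Variables (R : realType) (C : complexField R) (d : nat).
Implicit Types (U V H X Y T G L S A Q Z K W P : 'M[C]_d) (x y c tau : 'rV[R]_d).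
Variables (N : 'M[C]_d -> R) (hN : uinorm N).

Lemma l1norm_le_entries X (m : R) : (forall k l, cabs (X k l) <= m) ->
  l1norm X <= sqdim R d * m.
Proof.
move=> h; apply: (@le_trans _ _ (\sum_(i < d) \sum_(j < d) m)).
  by apply: ler_sum => i _; apply: ler_sum => j _; apply: h.
rewrite !big_const_ord !iter_addr_0 -mulrnA -mulr_natl.
by rewrite lexx.
Qed.

(** As the products agree, [(m1 - s1) * (m1 - s2)] is [m1] times the difference
    of the sums, hence negative. *)
Lemma between (s1 s2 m1 m2 : R) : 0 < s1 -> s1 < s2 ->
  m1 + m2 < s1 + s2 -> m1 * m2 = s1 * s2 -> 0 < m1 + m2 ->
  [/\ s1 < m1, m1 < s2 & 0 < m2].
Proof.
move=> s10 s12 lt e pos.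
have m10 : 0 < m1 by nra.
have m20 : 0 < m2 by nra.
have h : (m1 - s1) * (m1 - s2) < 0 by nra.
split=> //; nra.
Qed.

Lemma planerot_near (i j : 'I_d) (ij : i != j) (p q : R) c :
  p ^+ 2 + q ^+ 2 = 1 -> 0 <= q ->
  0 <= p -> c 0 i <= c 0 j ->
  l1norm ((planerot C i j p q)^t* *m rdiag C c *m planerot C i j p q - rdiag C c) <=
    sqdim R d * (q * (c 0 j - c 0 i)).
Proof.
move=> pq q0 p0 cij; apply: l1norm_le_entries => k l.
rewrite planerot_diag // (block2_diag C ij c) subE !mxE -rmorphB cabs_rc.
have c0 : 0 <= c 0 j - c 0 i by rewrite subr_ge0.
have q1 : q <= 1 by nra.
have p1 : p <= 1 by nra.
have qq : q ^+ 2 * (c 0 j - c 0 i) <= q * (c 0 j - c 0 i).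
  by rewrite ler_wpM2r // expr2 ler_piMl.
have qp : p * q * (c 0 j - c 0 i) <= q * (c 0 j - c 0 i).
  by rewrite ler_wpM2r // ler_piMl.
have qc : 0 <= q * (c 0 j - c 0 i) by rewrite mulr_ge0.
have p2 : p ^+ 2 = 1 - q ^+ 2 by rewrite -pq addrK.
have b1 : `|p ^+ 2 * c 0 i + q ^+ 2 * c 0 j - c 0 i| <= q * (c 0 j - c 0 i).
  have -> : p ^+ 2 * c 0 i + q ^+ 2 * c 0 j - c 0 i = q ^+ 2 * (c 0 j - c 0 i).
    by rewrite p2; ring.
  by rewrite ger0_norm // mulr_ge0 // sqr_ge0.
have b2 : `|q ^+ 2 * c 0 i + p ^+ 2 * c 0 j - c 0 j| <= q * (c 0 j - c 0 i).
  have -> : q ^+ 2 * c 0 i + p ^+ 2 * c 0 j - c 0 j = - (q ^+ 2 * (c 0 j - c 0 i)).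
    by rewrite p2; ring.
  by rewrite normrN ger0_norm // mulr_ge0 // sqr_ge0.
have b3 : `|p * q * (c 0 j - c 0 i) - 0| <= q * (c 0 j - c 0 i).
  by rewrite subr0 ger0_norm // !mulr_ge0.
have b5 (z : R) : `|z - z| <= q * (c 0 j - c 0 i) by rewrite subrr normr0.
case: ifP => ki; first by case: ifP => // li; case: ifP.
by case: ifP => kj //; case: ifP => // li; case: ifP.
Qed.

(** Rotating [G] in the plane of two misaligned eigenvectors keeps the product
    of the two eigenvalues concerned and decreases their sum.  By [between] the
    new logarithms are strict convex combinations of the old ones [x] and of
    [y], the old ones exchanged; exchanging does not change the norm. *)
Lemma local_min_ordered P tau c : P \is unitarymx ->
  (forall i, 0 < tau 0 i) -> (forall i, 0 < c 0 i) ->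
  local_min N (udiag P tau) (udiag P c) ->
  forall i j, tau 0 i < tau 0 j -> c 0 j <= c 0 i.
Proof.
move=> hP t0 c0 [e e0 hmin] i j tij; rewrite leNgt; apply/negP => cij.
have ij : i != j by apply: contraTneq tij => ->; rewrite ltxx.
have ji : (j == i) = false by rewrite eq_sym (negPf ij).
pose B := sqdim R d ^+ 2 * (sqdim R d * (c 0 j - c 0 i)).
have B0 : 0 <= B.
  by rewrite !mulr_ge0 ?exprn_ge0 ?sqdim_ge0 // subr_ge0 ltW.
pose q := Num.min 2^-1 (e / (B + 1) / 2).
have q0 : 0 < q by rewrite lt_min invr_gt0 ltr0n !divr_gt0 // ltr_wpDl.
have q1 : q <= 2^-1 by rewrite ge_min lexx.
have qB : q * B < e by apply: small_mul => //; rewrite ge_min lexx orbT.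
have q2 : 0 <= 1 - q ^+ 2.
  by rewrite subr_ge0 expr_le1 ?ltW //; lra.
pose p := Num.sqrt (1 - q ^+ 2).
have pq : p ^+ 2 + q ^+ 2 = 1 by rewrite sqr_sqrtr // subrK.
have p0 : 0 <= p by apply: sqrtr_ge0.
have hr := planerot_unitary C ij pq.
pose r := planerot C i j p q; pose U := P^t* *m r *m P.
have hU : U \is unitarymx by rewrite !mul_unitarymx ?adj_unitary.
have eU : U^t* *m udiag P c *m U = P^t* *m (r^t* *m rdiag C c *m r) *m P.
  rewrite /U !adjmxM trmxCK /udiag !mulmxA (mulmxtVK _ hP).
  by rewrite (mulmxtVK _ hP).
have near : l1norm (U^t* *m udiag P c *m U - udiag P c) < e.
  rewrite eU /udiag -mulmxBl -mulmxBr.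
  apply: le_lt_trans (l1norm_sandwich _ (adj_unitary hP) hP) _.
  apply: le_lt_trans qB; rewrite /B.
  have -> : q * (sqdim R d ^+ 2 * (sqdim R d * (c 0 j - c 0 i))) =
    sqdim R d ^+ 2 * (sqdim R d * (q * (c 0 j - c 0 i))) by ring.
  by rewrite ler_wpM2l ?exprn_ge0 ?sqdim_ge0 // planerot_near // ltW.
have := hmin U hU near; apply/negP; rewrite -ltNge.
pose s := \row_k (tau 0 k ^+ 2 * c 0 k).
have eS : udiag P tau *m udiag P c *m udiag P tau = udiag P s.
  by rewrite !udiagM //; congr udiag; apply/rowP=> k; rewrite !mxE; ring.
have s0 k : 0 < s 0 k by rewrite mxE mulr_gt0 // exprn_gt0.
have tt : tau 0 i ^+ 2 < tau 0 j ^+ 2.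
  by rewrite ltr_pXn2r // nnegrE ltW.
have sij : s 0 i < s 0 j.
  rewrite !mxE; apply: ltr_pM => //; last exact: ltW.
  by rewrite exprn_ge0 // ltW.
pose al := tau 0 i ^+ 2 * (p ^+ 2 * c 0 i + q ^+ 2 * c 0 j).
pose be := tau 0 i * tau 0 j * (p * q * (c 0 j - c 0 i)).
pose ga := tau 0 j ^+ 2 * (q ^+ 2 * c 0 i + p ^+ 2 * c 0 j).
have eS' : udiag P tau *m (U^t* *m udiag P c *m U) *m udiag P tau =
    P^t* *m block2 C i j s al be be ga *m P.
  rewrite eU planerot_diag // /udiag !mulmxA (mulmxtVK _ hP) (mulmxtVK _ hP).
  rewrite -!mulmxA; congr (_ *m _); rewrite !mulmxA; congr (_ *m _).
  rewrite !(block2_diag C ij tau) !block2_mul //.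
  have e1 : \row_k ((\row_k0 (tau 0 k0 * c 0 k0)) 0 k * tau 0 k) = s.
    by apply/rowP=> k; rewrite !mxE; ring.
  by rewrite e1; congr block2; rewrite /al /be /ga; ring.
have [p' [q' [m1 [m2 [pq' eal ebe ega]]]]] := diag2 al be ga.
pose m := \row_k (if k == i then m1 else if k == j then m2 else s 0 k).
have mi : m 0 i = m1 by rewrite mxE eqxx.
have mj : m 0 j = m2 by rewrite mxE ji eqxx.
pose r' := planerot C i j p' q'.
have hr' : r' \is unitarymx := planerot_unitary C ij pq'.
have eB : block2 C i j s al be be ga = r'^t* *m rdiag C m *m r'.
  rewrite planerot_diag // mi mj -eal -ebe -ega; apply: block2_ext => k ki kj.
  by rewrite [RHS]mxE (negPf ki) (negPf kj).
have eS2 : udiag P tau *m (U^t* *m udiag P c *m U) *m udiag P tau = udiag (r' *m P) m.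
  by rewrite eS' eB /udiag adjmxM !mulmxA.
have sum : m1 + m2 = al + ga.
  by rewrite eal ega; rewrite -[LHS]mul1r -pq'; ring.
have prod : m1 * m2 = s 0 i * s 0 j.
  transitivity (al * ga - be ^+ 2).
    by rewrite eal ega ebe -[LHS]mul1r -(expr1n _ 2) -pq'; ring.
  rewrite !mxE /al /ga /be -[RHS]mul1r -(expr1n _ 2) -pq; ring.
have lts : m1 + m2 < s 0 i + s 0 j.
  rewrite sum !mxE /al /ga -subr_gt0.
  have -> : tau 0 i ^+ 2 * c 0 i + tau 0 j ^+ 2 * c 0 j -
     (tau 0 i ^+ 2 * (p ^+ 2 * c 0 i + q ^+ 2 * c 0 j) +
      tau 0 j ^+ 2 * (q ^+ 2 * c 0 i + p ^+ 2 * c 0 j)) =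
     q ^+ 2 * (c 0 j - c 0 i) * (tau 0 j ^+ 2 - tau 0 i ^+ 2).
    have -> : p ^+ 2 = 1 - q ^+ 2 by rewrite -pq addrK.
    by ring.
  by rewrite !mulr_gt0 ?exprn_gt0 ?subr_gt0.
have pos : 0 < m1 + m2.
  rewrite sum /al /ga addr_gt0 // mulr_gt0 ?exprn_gt0 //.
    by rewrite ltr_wpDl ?mulr_gt0 ?exprn_gt0 // mulr_ge0 ?sqr_ge0 // ltW.
  by rewrite ltr_pwDl ?mulr_gt0 ?exprn_gt0 // mulr_ge0 ?sqr_ge0 // ltW.
have [s1 s2 m20] := between (s0 i) sij lts prod pos.
have m10 : 0 < m1 by apply: lt_trans s1.
pose x := map_mx (@ln R) s.
pose y := \row_k (if k == i then x 0 j else if k == j then x 0 i else x 0 k).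
(* the quarter turn exchanges the two entries *)
have ey : N (rdiag C y) = N (rdiag C x).
  have hr1 : planerot C i j 0 1 \is unitarymx by apply: planerot_unitary => //; ring.
  rewrite -(un_conj hN (rdiag C x) hr1) planerot_diag //; congr N.
  rewrite (block2_diag C ij) !mxE !eqxx ji.
  rewrite (@block2_ext _ C _ i j y x) => [|k ki kj].
    by congr block2; ring.
  by rewrite [LHS]mxE (negPf ki) (negPf kj).
have xE k : x 0 k = ln (s 0 k) by rewrite mxE.
have xij : 0 < x 0 j - x 0 i by rewrite subr_gt0 !xE ltr_ln ?posrE.
have l1 : x 0 i < ln m1 by rewrite xE ltr_ln ?posrE.
have l2 : ln m1 < x 0 j by rewrite xE ltr_ln ?posrE.
have l12 : ln m1 + ln m2 = x 0 i + x 0 j.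
  by rewrite -lnM ?posrE // prod lnM ?posrE // !xE.
pose t := (x 0 j - ln m1) / (x 0 j - x 0 i).
have t0' : 0 < t by rewrite divr_gt0 // subr_gt0.
have t1 : t < 1 by rewrite ltr_pdivrMr // mul1r ltrD2l ltrN2.
have tE : t * (x 0 j - x 0 i) = x 0 j - ln m1 by rewrite divfK // gt_eqF.
have em : map_mx (@ln R) m = t *: x + (1 - t) *: y.
  have lin (u v : 'rV[R]_d) (a b : R) k :
    (a *: u + b *: v) 0 k = a * u 0 k + b * v 0 k by rewrite !mxE.
  apply/rowP=> k; rewrite mapE lin [m 0 k]mxE [y 0 k]mxE.
  have [->|ki] := eqVneq k i; first by lra.
  have [->|kj] := eqVneq k j; first by lra.
  by rewrite -xE; ring.
have xy : x != y.
  apply: contraTneq xij => /rowP/(_ i); rewrite [y 0 i]mxE eqxx => ->.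
  by rewrite subrr ltxx.
have hPr : r' *m P \is unitarymx by rewrite mul_unitarymx.
rewrite eS2 eS !mxlog_udiag // !un_udiag // em -ey.
by apply: un_strict => //; rewrite ey.
Qed.
End Ordering.

(** * Sorted eigenvalues *)

Section Eigenvalues.
Variables (R : realType) (C : complexField R) (d : nat).
Implicit Types (U V H X Y T G S A Q P : 'M[C]_d) (x y a c tau : 'rV[R]_d).

Definition eigs A : 'rV[R]_d :=
  \row_i nth 0 (sort >=%R [seq re (spectral_diag A 0 j) | j <- enum 'I_d]) i.

Lemma char_poly_udiag U a : U \is unitarymx ->
  char_poly (udiag U a) =
    \prod_(x <- [seq rc (a 0 j) : C | j <- enum 'I_d]) ('X - x%:P).
Proof.
move=> hU; transitivity (char_poly (rdiag C a)).
  have eU : map_mx polyC (U^t*) *m map_mx polyC U = 1%:M.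
    by rewrite -map_mxM unitaryr // map_mx1.
  rewrite /char_poly.
  have -> : char_poly_mx (udiag U a) = map_mx polyC (U^t*) *m
      char_poly_mx (rdiag C a) *m map_mx polyC U.
    rewrite /char_poly_mx mulmxBr mulmxBl /udiag !map_mxM scalar_mxC.
    by rewrite -(mulmxA _ (map_mx polyC (U^t*)) (map_mx polyC U)) eU mulmx1.
  rewrite !det_mulmx mulrC mulrA [X in X * _]mulrC -det_mulmx eU.
  by rewrite det1 mul1r.
rewrite char_poly_trig; last first.
  by apply/is_trig_mxP => i j ij; rewrite rdiagE lt_eqF.
rewrite big_map big_enum /=; apply: eq_bigr => i _.
by rewrite rdiagE eqxx mulr1n.
Qed.

(** Both lists are the roots of the characteristic polynomial. *)
Lemma udiag_perm_eq U V a c : U \is unitarymx -> V \is unitarymx ->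
  udiag U a = udiag V c ->
  perm_eq [seq a 0 j | j <- enum 'I_d] [seq c 0 j | j <- enum 'I_d].
Proof.
move=> hU hV e; have := char_poly_udiag a hU; rewrite e char_poly_udiag //.
move=> /prod_XsubC_eq h; apply: (@perm_map_inj _ _ (rc : R -> C)).
  exact: rc_inj.
by rewrite -!(map_comp rc) perm_sym.
Qed.

Lemma eigs_udiag U a : U \is unitarymx ->
  eigs (udiag U a) = \row_i nth 0 (sort >=%R [seq a 0 j | j <- enum 'I_d]) i.
Proof.
move=> hU; have e := herm_udiag (udiag_adj U a).
have := udiag_perm_eq hU (spectral_unitarymx (udiag U a)) e.
set b := \row_j _ => h; apply/rowP=> i; rewrite !mxE; congr nth.
have -> : [seq re (spectral_diag (udiag U a) 0 j) | j <- enum 'I_d] =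
    [seq b 0 j | j <- enum 'I_d] by apply: eq_map => j; rewrite mxE.
apply/eqP; rewrite eq_sym; apply/eqP/perm_sortP => //.
- exact: ge_total.
- exact: ge_trans.
- exact: ge_anti.
Qed.

Lemma udiag_reindex (f : 'I_d -> 'I_d) P a : injective f ->
  udiag P a = udiag (\matrix_(k, l) P (f k) l) (\row_k a 0 (f k)).
Proof.
move=> fI; apply/matrixP=> k l; rewrite /udiag -!mulmxA !mulE.
rewrite (reindex_inj fI) /=; apply: eq_bigr => m _.
by rewrite !adjE !mul_rdiagE !mxE.
Qed.

Lemma reindex_unitary (f : 'I_d -> 'I_d) P : injective f -> P \is unitarymx ->
  (\matrix_(k, l) P (f k) l : 'M[C]_d) \is unitarymx.
Proof.
move=> fI /unitaryl /matrixP hP; apply/unitarymxP/matrixP => k l.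
have := hP (f k) (f l); rewrite !mulE ![1%:M _ _]mxE (inj_eq fI) => <-.
by apply: eq_bigr => m _; rewrite !adjE !mxE.
Qed.

(** The hypothesis makes the product order on the indices total, and sorting the
    indices by it sorts both vectors. *)
Lemma cosort a c : (forall i j, a 0 j < a 0 i -> c 0 j <= c 0 i) ->
  exists2 f : 'I_d -> 'I_d, injective f &
    forall i, a 0 (f i) = nth 0 (sort >=%R [seq a 0 j | j <- enum 'I_d]) i /\
              c 0 (f i) = nth 0 (sort >=%R [seq c 0 j | j <- enum 'I_d]) i.
Proof.
move=> h; pose r i j := (a 0 j <= a 0 i) && (c 0 j <= c 0 i).
have r_total : total r.
  move=> i j; rewrite /r; case: (ltgtP (a 0 i) (a 0 j)) => [lt|lt|e] /=.
  - by rewrite (h _ _ lt) ?orbT.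
  - by rewrite (h _ _ lt).
  - exact: le_total.
have r_trans : transitive r.
  move=> j i k /andP[h1 h2] /andP[h3 h4].
  by rewrite /r (le_trans h3 h1) (le_trans h4 h2).
pose s := sort r (enum 'I_d).
have ss : sorted r s := sort_sorted r_total _.
have sz : size s = d by rewrite size_sort size_enum_ord.
have su : uniq s by rewrite sort_uniq enum_uniq.
pose f (i : 'I_d) := nth i s i.
exists f.
  move=> i k; rewrite /f (set_nth_default i) ?sz // => /eqP.
  by rewrite nth_uniq ?sz // => /eqP /val_inj.
have key (x : 'rV[R]_d) i : {homo (fun k => x 0 k) : k l / r k l >-> l <= k} ->
    x 0 (f i) = nth 0 (sort >=%R [seq x 0 j | j <- enum 'I_d]) i.
  move=> hx; have -> : sort >=%R [seq x 0 j | j <- enum 'I_d] = [seq x 0 j | j <- s].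
    apply: (@sorted_eq _ >=%R) => //.
    - exact: ge_trans.
    - exact: ge_anti.
    - exact: sort_sorted ge_total _.
    - by apply: homo_sorted ss.
    - by rewrite perm_sort perm_map // perm_sym perm_sort.
  by rewrite (nth_map i) ?sz.
by move=> i; split; apply: key => k l /andP[].
Qed.

Lemma aligned_ordered P a c : P \is unitarymx ->
  (forall i j, a 0 j < a 0 i -> c 0 j <= c 0 i) ->
  exists U, [/\ U \is unitarymx,
    U^t* *m udiag P a *m U = rdiag C (eigs (udiag P a)) &
    U^t* *m udiag P c *m U = rdiag C (eigs (udiag P c))].
Proof.
move=> hP /cosort [f fI hf]; pose Q : 'M[C]_d := \matrix_(k, l) P (f k) l.
have hQ : Q \is unitarymx := reindex_unitary fI hP.
exists (Q^t*); split; first exact: adj_unitary.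
  rewrite trmxCK eigs_udiag // (udiag_reindex _ _ fI) udiag_diag //.
  by congr rdiag; apply/rowP=> i; rewrite !mxE; case: (hf i).
rewrite trmxCK eigs_udiag // (udiag_reindex _ _ fI) udiag_diag //.
by congr rdiag; apply/rowP=> i; rewrite !mxE; case: (hf i).
Qed.

Lemma comm_sandwich A T G : T \in unitmx -> A *m T = T *m A ->
  A *m (T *m G *m T) = T *m G *m T *m A -> A *m G = G *m A.
Proof.
move=> uT AT e.
have {}e : T *m (A *m G) *m T = T *m (G *m A) *m T.
  rewrite !mulmxA -AT -[RHS]mulmxA [in RHS]AT [RHS]mulmxA -e.
  by rewrite !mulmxA.
have := congr1 (fun M => invmx T *m M *m invmx T) e.
by rewrite /= -!(mulmxA T) !mulKmx // !mulmxK.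
Qed.

Definition rsqrt A : 'M[C]_d := fcalc (fun t => (Num.sqrt t)^-1) A.

Variables (N : 'M[C]_d -> R) (hN : uinorm N).

(** [A] is a function of [T T], and [T] of [A], so that commutation of [S] with
    [T T] passes to [G] and [A]; in a common eigenbasis [local_min_ordered]
    applies. *)
Lemma local_min_aligned A G : pd A -> pd G -> local_min N (rsqrt A) G ->
  exists U, [/\ U \is unitarymx, U^t* *m A *m U = rdiag C (eigs A) &
    U^t* *m G *m U = rdiag C (eigs G)].
Proof.
move=> pA pG hmin; have [P [a [hP a0 eA]]] := pd_udiag pA.
pose g (t : R) := (Num.sqrt t)^-1.
have g0 t : 0 < t -> 0 < g t by move=> t0; rewrite invr_gt0 sqrtr_gt0.
have eT : rsqrt A = udiag P (map_mx g a) by rewrite eA; apply: fcalc_udiag.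
have hT : (rsqrt A)^t* = rsqrt A by rewrite eT udiag_adj.
have uT : rsqrt A \in unitmx.
  rewrite eT; have := udiag_inv hP (a := map_mx g a).
  case/(_ _)/mulmx1_unit => // i; rewrite mapE; exact: g0.
have TTS := local_min_comm hN hT uT pG hmin.
have AG : A *m G = G *m A.
  have AS : A *m (rsqrt A *m G *m rsqrt A) = rsqrt A *m G *m rsqrt A *m A.
    have eTT : rsqrt A *m rsqrt A = udiag P (map_mx (fun t => t^-1) a).
      rewrite eT udiagM //; congr udiag; apply/rowP=> i; rewrite !mxE /g -expr2.
      by rewrite exprVn sqr_sqrtr // ltW.
    have eA2 : udiag P (map_mx (fun t => t^-1) (map_mx (fun t => t^-1) a)) = A.
      by rewrite eA; congr udiag; apply/rowP=> i; rewrite !mxE invrK.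
    by have := TTS; rewrite eTT => /(comm_fun (fun t => t^-1) hP); rewrite eA2.
  have AT : A *m rsqrt A = rsqrt A *m A by rewrite eT {1 2}eA udiagC.
  exact: comm_sandwich uT AT AS.
have [P' [a' [c [hP' eA' eG]]]] := simdiag pA.1 pG.1 AG.
have a'0 i : 0 < a' 0 i by apply: pd_udiag_gt0 hP' _; rewrite -eA'.
have c0 i : 0 < c 0 i by apply: pd_udiag_gt0 hP' _; rewrite -eG.
have eT' : rsqrt A = udiag P' (map_mx g a') by rewrite eA'; apply: fcalc_udiag.
rewrite eA' eG; apply: aligned_ordered => // i j ji.
have : local_min N (udiag P' (map_mx g a')) (udiag P' c) by rewrite -eT' -eG.
move/local_min_ordered; apply=> //; first by move=> k; rewrite mapE g0.
by rewrite !mapE ltf_pV2 ?posrE ?sqrtr_gt0 // ltr_sqrt.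
Qed.

End Eigenvalues.

(** * Existence of a global minimizer *)

Import numFieldNormedType.Exports.

Section Existence.
Variables (R : realType) (C : complexField R) (d : nat).
Implicit Types (U V H X Y T G S A B Q P : 'M[C]_d) (x y a c tau : 'rV[R]_d).
Variables (N : 'M[C]_d -> R) (hN : uinorm N).

Lemma orbit_lip B U U' : U \is unitarymx -> U' \is unitarymx ->
  l1norm (U^t* *m B *m U - U'^t* *m B *m U') <=
    sqdim R d * l1norm B *+ 2 * l1norm (U - U').
Proof.
move=> hU hU'.
have -> : U^t* *m B *m U - U'^t* *m B *m U' =
    (U - U')^t* *m B *m U + U'^t* *m B *m (U - U').
  by rewrite adjmxB !mulmxBl mulmxBr addrA subrK.
apply: le_trans (l1normD _ _) _; rewrite mulr2n mulrDl; apply: lerD.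
  apply: le_trans (l1norm_mul3 _ _ _) _; rewrite l1norm_adj.
  have -> : sqdim R d * l1norm B * l1norm (U - U') =
      l1norm (U - U') * l1norm B * sqdim R d by ring.
  by rewrite ler_wpM2l ?mulr_ge0 ?l1norm_ge0 // l1norm_unitary.
apply: le_trans (l1norm_mul3 _ _ _) _; rewrite ler_wpM2r ?l1norm_ge0 //.
by rewrite ler_wpM2r ?l1norm_ge0 // l1norm_adj l1norm_unitary.
Qed.

Definition cost T B U : R := N (mxlog (T *m (U^t* *m B *m U) *m T)).

Lemma cost_lip T B : T^t* = T -> T \in unitmx -> pd B ->
  exists2 k, 0 <= k & forall U U', U \is unitarymx -> U' \is unitarymx ->
    cost T B U <= cost T B U' + k * l1norm (U - U').
Proof.
move=> hT uT pB; have [c c0 hc] := un_lip hN.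
have [B' BB'] := pd_inv pB.
pose kB := l1norm (invmx T) * (sqdim R d ^+ 2 * l1norm B') * l1norm (invmx T).
have kB0 : 0 <= kB by rewrite !mulr_ge0 ?exprn_ge0 ?sqdim_ge0 ?l1norm_ge0.
pose M := sqdim R d ^+ 4 * (sqdim R d ^+ 2 * kB *+ 2).
have M0 : 0 <= M.
  by apply: mulr_ge0; last apply: mulrn_wge0 (mulr_ge0 _ kB0);
     apply: exprn_ge0 (sqdim_ge0 R d).
pose k := c * (M * (l1norm T * (sqdim R d * l1norm B *+ 2) * l1norm T)).
have L0 : 0 <= sqdim R d * l1norm B *+ 2.
  by rewrite mulrn_wge0 ?mulr_ge0 ?sqdim_ge0 ?l1norm_ge0.
exists k; first by do 2!apply: mulr_ge0 => //; rewrite !mulr_ge0 ?l1norm_ge0.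
have pS U : U \is unitarymx -> pd (T *m (U^t* *m B *m U) *m T).
  move=> hU; have pU : pd (U^t* *m B *m U).
    by apply: pd_sandwich pB; apply: unitarymx_unit.
  by have := pd_sandwich uT pU; rewrite hT.
have iS U : U \is unitarymx -> exists2 S', T *m (U^t* *m B *m U) *m T *m S' = 1%:M &
    l1norm S' <= kB.
  move=> hU; exists (invmx T *m (U^t* *m B' *m U) *m invmx T).
    exact: sandwich_inv uT (conj_inv hU BB').
  apply: le_trans (l1norm_mul3 _ _ _) _; rewrite ler_wpM2r ?l1norm_ge0 //.
  rewrite ler_wpM2l ?l1norm_ge0 //.
  exact: l1norm_sandwich (adj_unitary hU) hU.
move=> U U' hU hU'; apply: le_trans (hc _ (mxlog (T *m (U'^t* *m B *m U') *m T))) _.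
rewrite lerD2l /k -[leRHS]mulrA ler_wpM2l //.
have [S1 e1 n1] := iS U hU; have [S2 e2 n2] := iS U' hU'.
apply: le_trans (mxlog_lip (pS U hU) (pS U' hU') e1 e2 n1 n2) _.
rewrite -/M -[leRHS]mulrA ler_wpM2l //.
rewrite -mulmxBl -mulmxBr; apply: le_trans (l1norm_mul3 _ _ _) _.
rewrite [leRHS]mulrAC ler_wpM2r ?l1norm_ge0 // -[leRHS]mulrA ler_wpM2l ?l1norm_ge0 //.
exact: orbit_lip.
Qed.

Local Notation idx := ('I_d * 'I_d * bool)%type.

(** Real coordinates on matrices; they make the unitary group a compact subset
    of a Euclidean space. *)
Definition mx_of (v : 'rV[R]_(#|{: idx}|)) : 'M[C]_d :=
  \matrix_(i, j) (rc (v 0 (enum_rank (i, j, false))) +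
                  'i * rc (v 0 (enum_rank (i, j, true)))).

Definition coords X : 'rV[R]_(#|{: idx}|) :=
  \row_k (let: (i, j, b) := enum_val k in
          if b then re ('Im (X i j)) else re ('Re (X i j))).

Lemma coordsK X : mx_of (coords X) = X.
Proof.
apply/matrixP=> i j; rewrite !mxE !enum_rankK !reK ?Creal_Re ?Creal_Im //.
by rewrite -Crect.
Qed.

Lemma coord_le_norm n (v : 'rV[R]_n) k : `|v 0 k| <= `|v|.
Proof.
rewrite [leRHS]/Num.norm /= mx_normrE.
by apply/bigmax_geP; right => /=; exists (0, k).
Qed.

Lemma l1norm_mx_of v w : l1norm (mx_of v - mx_of w) <= sqdim R d * (`|v - w| *+ 2).
Proof.
apply: l1norm_le_entries => i j; rewrite subE !mxE.
set a := enum_rank _; set b := enum_rank _.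
have -> : rc (v 0 a) + 'i * rc (v 0 b) - (rc (w 0 a) + 'i * rc (w 0 b)) =
    rc ((v - w) 0 a) + 'i * rc ((v - w) 0 b) :> C.
  by rewrite !mxE !rmorphB; ring.
apply: le_trans (cabsD _ _) _; rewrite mulr2n lerD //.
  by rewrite cabs_rc coord_le_norm.
rewrite cabsM cabs_rc {1}/cabs normCi -(rmorph1 rc) rcK mul1r.
exact: coord_le_norm.
Qed.

Lemma near_mx_of v (e : R) : 0 < e ->
  \forall w \near v, l1norm (mx_of v - mx_of w) < e.
Proof.
move=> e0; have d0 := sqdim_ge0 R d.
have e'0 : 0 < e / (sqdim R d *+ 2 + 1) / 2.
  by rewrite !divr_gt0 // ltr_wpDl // mulrn_wge0.
near=> w; have /ltW h : `|v - w| < e / (sqdim R d *+ 2 + 1) / 2.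
  by near: w; apply: (@cvgr_dist_lt _ _ _ (nbhs v) _ id v cvg_id).
apply: le_lt_trans (l1norm_mx_of v w) _.
have [->|vw] := eqVneq v w; first by rewrite subrr normr0 mul0rn mulr0.
rewrite mulrnAr -mulrnAl mulrC; apply: small_mul => //.
  by rewrite normr_gt0 subr_eq0.
by rewrite mulrn_wge0.
Unshelve. all: by end_near. Qed.

Lemma l1norm_eq0 X : l1norm X <= 0 -> X = 0.
Proof.
move=> h; apply/matrixP=> i j; rewrite mxE; apply/eqP; rewrite -normr_eq0.
rewrite -rc_cabs (_ : cabs _ = 0) ?rmorph0 //; apply/eqP.
by rewrite eq_le cabs_ge0 andbT (le_trans (cabs_le_l1norm X i j)).
Qed.

Lemma closed_unitary : closed [set v | mx_of v \is unitarymx]%classic.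
Proof.
move=> v clv; rewrite /=; set X := mx_of v.
apply/unitarymxP/eqP; rewrite -subr_eq0; apply/eqP/l1norm_eq0; rewrite leNgt.
apply/negP => x0; set x := l1norm _ in x0.
(* a unitary matrix this close to [X] would make the defect of [X] smaller than
   it is *)
pose b := l1norm X + sqdim R d.
have b0 : 0 <= b by rewrite addr_ge0 ?l1norm_ge0 ?sqdim_ge0.
have e0 : 0 < x / (b + 1) / 2 by rewrite !divr_gt0 // ltr_wpDl.
have [w [hw /ltW nw]] := clv _ (near_mx_of v e0).
set Y := mx_of w in nw; rewrite /= -/Y in hw.
suff : x < x by rewrite ltxx.
have dX : X *m X^t* - 1%:M = X *m (X - Y)^t* + (X - Y) *m Y^t*.
  by rewrite -(unitaryl hw) adjmxB mulmxBr mulmxBl addrA subrK.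
have h1 : x <= l1norm (X - Y) * b.
  rewrite /x dX; apply: le_trans (l1normD _ _) _; rewrite /b mulrDr; apply: lerD.
    by apply: le_trans (l1normM _ _) _; rewrite l1norm_adj mulrC.
  apply: le_trans (l1normM _ _) _; rewrite l1norm_adj ler_wpM2l ?l1norm_ge0 //.
  exact: l1norm_unitary.
have [n0|n0] := eqVneq (l1norm (X - Y)) 0.
  by move: x0; rewrite ltNge (le_trans h1) // n0 mul0r.
apply: le_lt_trans h1 _; apply: small_mul => //.
by rewrite lt_neqAle eq_sym n0 l1norm_ge0.
Qed.

Lemma cube_compact n : compact
  [set v : 'rV[R]_n | forall i, (v ord0 i \in `[(-1), 1])%R]%classic.
Proof.
apply: (@rV_compact _ _ (fun=> `[(-1 : R), 1]%classic)) => _.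
exact: segment_compact.
Qed.

Lemma norm_re_le (x z : C) : x \is Num.real -> `|x| ^+ 2 <= `|z| ^+ 2 ->
  `|re x| <= cabs z.
Proof.
move=> xR h; rewrite -(ler_rc C) rc_cabs -(cabs_rc C) rc_cabs reK //.
by move: h; rewrite ler_sqr ?nnegrE ?normr_ge0.
Qed.

Lemma norm_Re_le z : `|re ('Re z : C)| <= cabs z.
Proof.
apply: norm_re_le; rewrite ?Creal_Re // real_normK ?Creal_Re // normC2_Re_Im.
by rewrite lerDl real_exprn_even_ge0 ?Creal_Im.
Qed.

Lemma norm_Im_le z : `|re ('Im z : C)| <= cabs z.
Proof.
apply: norm_re_le; rewrite ?Creal_Im // real_normK ?Creal_Im // normC2_Re_Im.
by rewrite lerDr real_exprn_even_ge0 ?Creal_Re.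
Qed.

(** The cost is Lipschitz on the unitary group, which is compact in real
    coordinates. *)
Lemma orbit_min T B : T^t* = T -> T \in unitmx -> pd B ->
  exists2 U0, U0 \is unitarymx &
    forall U, U \is unitarymx -> cost T B U0 <= cost T B U.
Proof.
move=> hT uT pB; have [k k0 hk] := cost_lip hT uT pB.
have ccube := @cube_compact #|{: idx}|.
set cube := mkset _ in ccube.
pose K := (cube `&` [set v | mx_of v \is unitarymx])%classic.
have cK : compact K by apply: compact_closedI => //; apply: closed_unitary.
have inK U : U \is unitarymx -> K (coords U).
  move=> hU; split; rewrite /= ?coordsK // => i.
  rewrite in_itv /= -ler_norml mxE; case: (enum_val i) => -[l m] b.
  apply: le_trans (cabs_unitary l m hU).
  by case: b; [apply: norm_Im_le | apply: norm_Re_le].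
have contf : {within K, continuous (fun v => cost T B (mx_of v))}%classic.
  apply/subspace_continuousP => v [_ hv].
  apply/cvgrPdist_lt => e e0.
  have e'0 : 0 < e / (k + 1) / 2 by rewrite !divr_gt0 // ltr_wpDl.
  rewrite near_withinE; have := near_mx_of v e'0.
  apply: filterS => w /ltW nw [_ hw].
  have h1 := hk _ _ hv hw; have h2 := hk _ _ hw hv.
  have h3 : k * l1norm (mx_of v - mx_of w) < e.
    have [->|n0] := eqVneq (l1norm (mx_of v - mx_of w)) 0; first by rewrite mulr0.
    rewrite mulrC; apply: small_mul => //.
    by rewrite lt_neqAle eq_sym n0 l1norm_ge0.
  rewrite l1norm_distC in h2.
  have key (p q r : R) : p <= q + r -> q <= p + r -> r < e -> `|p - q| < e.
    by clear=> *; rewrite ltr_norml; apply/andP; split; lra.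
  exact: key h1 h2 h3.
have [|v vK hv] := compact_EVT_min _ cK contf.
  by exists (coords 1%:M); apply: inK; apply: unitary1.
rewrite inE in vK; exists (mx_of v); first by case: vK.
move=> U hU; rewrite -(coordsK U); apply: hv.
by rewrite inE; apply: inK.
Qed.

End Existence.

(** * From local to global minimizers *)

Section Abstract.
Variables (R : realType) (C : complexField R) (d : nat).
Implicit Types (U V H X Y T G S A B Q P : 'M[C]_d) (x y a c tau : 'rV[R]_d).
Variables (N : 'M[C]_d -> R) (hN : uinorm N).

Lemma aligned_value U a c : U \is unitarymx -> (forall i, 0 < a 0 i) ->
  let T := rsqrt (udiag U a) in
  N (mxlog (T *m udiag U c *m T)) = N (rdiag C (\row_i ln (c 0 i / a 0 i))).
Proof.
move=> hU a0 T; rewrite /T /rsqrt fcalc_udiag // !udiagM // mxlog_udiag // un_udiag //.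
congr (N (rdiag C _)); apply/rowP=> i; rewrite !mxE; congr ln.
by rewrite mulrAC mulrC -invfM -expr2 sqr_sqrtr // ltW.
Qed.

Lemma eigs_conj V B : V \is unitarymx -> B^t* = B ->
  eigs (V^t* *m B *m V) = eigs B.
Proof.
move=> hV /herm_ex [U [a [hU ->]]].
by rewrite udiag_conj !eigs_udiag // mul_unitarymx.
Qed.

Lemma orbit_mul V (W : 'M[C]_d) B :
  W^t* *m (V^t* *m B *m V) *m W = (V *m W)^t* *m B *m (V *m W).
Proof. by rewrite adjmxM !mulmxA. Qed.

(** A global minimizer [U0] exists and is a local one, so both points are
    aligned with [A]; there the cost is a function of the eigenvalues of [A]
    and [B]. *)
Lemma local_min_global A B V : pd A -> pd B -> V \is unitarymx ->
  local_min N (rsqrt A) (V^t* *m B *m V) ->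
  (exists U, [/\ U \is unitarymx, U^t* *m A *m U = rdiag C (eigs A) &
     U^t* *m (V^t* *m B *m V) *m U = rdiag C (eigs B)]) /\
  forall U, U \is unitarymx -> cost N (rsqrt A) B V <= cost N (rsqrt A) B U.
Proof.
move=> pA pB hV hmin.
have pO U : U \is unitarymx -> pd (U^t* *m B *m U).
  by move=> hU; apply: pd_sandwich pB; apply: unitarymx_unit.
have al U : U \is unitarymx -> local_min N (rsqrt A) (U^t* *m B *m U) ->
    exists Q, [/\ Q \is unitarymx, Q^t* *m A *m Q = rdiag C (eigs A) &
     Q^t* *m (U^t* *m B *m U) *m Q = rdiag C (eigs B)].
  move=> hU lm; have [Q] := local_min_aligned hN pA (pO U hU) lm.
  by rewrite (eigs_conj hU pB.1); exists Q.
have val U : U \is unitarymx -> local_min N (rsqrt A) (U^t* *m B *m U) ->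
    cost N (rsqrt A) B U =
      N (rdiag C (\row_i ln (eigs B 0 i / eigs A 0 i))).
  move=> hU lm; have [Q [hQ eA eB]] := al U hU lm.
  have back X x : Q^t* *m X *m Q = rdiag C x -> X = udiag (Q^t*) x.
    move=> e; rewrite /udiag trmxCK -e !mulmxA (unitKr _ hQ).
    by rewrite (mulmxtVK _ hQ).
  have hQ' := adj_unitary hQ.
  rewrite /cost (back _ _ eB) {1 2}(back _ _ eA) aligned_value // => i.
  by apply: pd_udiag_gt0 hQ' _; rewrite -(back _ _ eA).
split; first exact: al.
have [P [a [hP a0 eA]]] := pd_udiag pA.
have g0 i : 0 < map_mx (fun t => (Num.sqrt t)^-1) a 0 i.
  by rewrite mapE invr_gt0 sqrtr_gt0.
have eT : rsqrt A = udiag P (map_mx (fun t => (Num.sqrt t)^-1) a).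
  by rewrite eA; apply: fcalc_udiag.
have hT : (rsqrt A)^t* = rsqrt A by rewrite eT udiag_adj.
have uT : rsqrt A \in unitmx by rewrite eT; case: (mulmx1_unit (udiag_inv hP g0)).
have [U0 hU0 hmin0] := orbit_min hN hT uT pB.
have lm0 : local_min N (rsqrt A) (U0^t* *m B *m U0).
  exists 1 => // W hW _; have := hmin0 (U0 *m W) (mul_unitarymx hU0 hW).
  by rewrite /cost -orbit_mul.
by move=> U hU; rewrite (val V hV hmin) -(val U0 hU0 lm0); apply: hmin0.
Qed.
End Abstract.

(** * The complex numbers *)

Section Bridge.
Variable R : realType.

Lemma complex_reK (z : R[i]) : z \is Num.real -> real_complex R (complex.Re z) = z.
Proof. exact: RRe_real. Qed.

Definition complexR : complexField R :=
  @ComplexField R R[i] (real_complex R) (@complex.Re R) (@lecR R) complex_reK.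

Variable d : nat.
Implicit Types A B M : 'M[R[i]]_d.

Lemma posdef_pd A : posdef A -> @pd R complexR d A.
Proof. by case=> /(@hermmxP R complexR d A) hA pA; split. Qed.

Lemma uinorm_of (N : 'M[R[i]]_d -> R) :
  strictly_convex_ui_norm N -> @uinorm R complexR d N.
Proof.
case=> [[tri hom def]] inv sc; split=> //.
move=> a b na nb ab t t0 t1.
have ab' : map_mx (real_complex R) a != map_mx (real_complex R) b.
  by apply: contraNneq ab => /matrixP e; apply/eqP/rowP=> i;
     have := e 0 i; rewrite !mxE => /complexI.
have := sc _ _ na nb ab' t t0 t1.
by rewrite linearD !linearZ.
Qed.

Lemma l2norm_le_sum (v : 'cV[R[i]]_d) :
  l2norm v <= \sum_i @cabs R complexR (v i 0).
Proof.
have s0 : 0 <= \sum_i @cabs R complexR (v i 0).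
  by apply: sumr_ge0 => i _; apply: (@cabs_ge0 R complexR).
rewrite -[leRHS]ger0_norm // -sqrtr_sqr ler_sqrt ?sqr_ge0 //.
rewrite expr2 mulr_suml; apply: ler_sum => i _.
rewrite expr2 ler_wpM2l ?(@cabs_ge0 R complexR) //.
rewrite (bigD1 i) //= lerDl; apply: sumr_ge0 => j _.
exact: (@cabs_ge0 R complexR).
Qed.

Lemma cabs_le_l2norm (v : 'cV[R[i]]_d) i :
  @cabs R complexR (v i 0) <= l2norm v.
Proof.
rewrite -[leLHS]ger0_norm ?(@cabs_ge0 R complexR) // -sqrtr_sqr ler_sqrt.
  by rewrite (bigD1 i) //= lerDl; apply: sumr_ge0 => j _; apply: sqr_ge0.
by apply: sumr_ge0 => j _; apply: sqr_ge0.
Qed.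

(** Every neighbourhood for the operator norm contains one for the entrywise
    norm. *)
Lemma opnorm_le_l1norm (X : 'M[R[i]]_d) : opnorm X <= @l1norm R complexR d X.
Proof.
apply: ge_sup.
  exists (l2norm (X *m 0)), 0 => //=.
  rewrite /l2norm big1 ?sqrtr0 // => i _.
  by rewrite mxE normr0 /= expr0n.
move=> _ [v /= v1 <-]; apply: le_trans (l2norm_le_sum _) _.
apply: ler_sum => i _; rewrite mxE.
apply: le_trans (@cabs_sum R complexR _ _ _ _) _; apply: ler_sum => j _.
rewrite (@cabsM R complexR) ler_piMr ?(@cabs_ge0 R complexR) //.
exact: le_trans (cabs_le_l2norm v j) v1.
Qed.

End Bridge.

Theorem theorem4p1 (R : realType) (d : nat) (A B : 'M[R[i]]_d)
    (N : 'M[R[i]]_d -> R) (C0 : 'M[R[i]]_d) :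
  posdef A -> posdef B -> strictly_convex_ui_norm N ->
  local_minimizer (F_ N A) (unitary_orbit B) C0 ->
  (exists U : 'M[R[i]]_d,
     [/\ U \is unitarymx,
         U^t* *m A *m U = diagC (eigvals A)
       & U^t* *m C0 *m U = diagC (eigvals B)])
  /\ global_minimizer (F_ N A) (unitary_orbit B) C0.
Proof.
move=> /posdef_pd pA /posdef_pd pB /uinorm_of hN [[V hV <-] [e e0 hmin]].
have lm : @local_min R (complexR R) d N (@rsqrt R (complexR R) d A)
      (V^t* *m B *m V).
  exists e; first exact: e0.
  move=> W hW nW.
  have oW : unitary_orbit B (W^t* *m (V^t* *m B *m V) *m W).
    exists (V *m W); first exact: mul_unitarymx hV hW.
    exact: esym (@orbit_mul R (complexR R) d V W B).
  have h := hmin _ oW (le_lt_trans (@opnorm_le_l1norm R d _) nW).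
  exact: h.
have [al glob] := local_min_global hN pA pB hV lm.
split; first exact: al.
split; first by exists V.
move=> _ [U hU <-]; exact: glob U hU.
Qed.
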